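(* Let $n\ge1$ and $\alpha\in(0,1)$. Let $A_{n,\alpha}>0$ be a constant depending only on $n$ and $\alpha$ with the following property (such a constant exists): for every set $E\subset\mathbb R^n$ with locally finite fractional Caccioppoli $\alpha$-perimeter in $\mathbb R^n$ and every $x\in\mathscr F^\alpha E$ there is $r_x>0$ such that $|D^\alpha\chi_E|(B_r(x))\le A_{n,\alpha}r^{n-\alpha}$ for all $r\in(0,r_x)$. Then, for every set $E$ with locally finite fractional Caccioppoli $\alpha$-perimeter in $\mathbb R^n$, $$|D^\alpha\chi_E|\le2^{n-\alpha}\,\frac{A_{n,\alpha}}{\omega_{n-\alpha}}\,\mathscr H^{n-\alpha}\llcorner\mathscr F^\alpha E$$ as measures on $\mathbb R^n$.
   Context: $\mathscr H^s$ is the $s$-dimensional Hausdorff measure (normalised with the constant $\omega_s$), $\omega_s:=\pi^{s/2}/\Gamma\big(\tfrac{s+2}{2}\big)$, $\llcorner$ denotes restriction of measures, $B_r(x)$ is the open ball. For $\alpha\in(0,1)$ let $\mu_{n,\alpha}:=2^\alpha\pi^{-n/2}\,\Gamma\big(\tfrac{n+\alpha+1}{2}\big)/\Gamma\big(\tfrac{1-\alpha}{2}\big)$. For $\varphi\in C^\infty_c(\mathbb R^n;\mathbb R^n)$, $$\mathrm{div}^\alpha\varphi(x):=\mu_{n,\alpha}\int_{\mathbb R^n}\frac{(y-x)\cdot(\varphi(y)-\varphi(x))}{|y-x|^{n+\alpha+1}}\,dy\in L^1(\mathbb R^n)\cap L^\infty(\mathbb R^n).$$ For a measurable set $E\subset\mathbb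 R^n$ and $U\subset\mathbb R^n$ open, $|D^\alpha\chi_E|(U):=\sup\{\int_E\mathrm{div}^\alpha\varphi\,dx:\varphi\in C^\infty_c(U;\mathbb R^n),\ \|\varphi\|_{L^\infty}\le1\}$. $E$ has locally finite fractional Caccioppoli $\alpha$-perimeter in $\mathbb R^n$ if $|D^\alpha\chi_E|(U)<+\infty$ for every bounded open $U$. In that case there is a unique $\mathbb R^n$-valued Radon measure $D^\alpha\chi_E$ on $\mathbb R^n$ (finite on bounded sets), with total variation measure $|D^\alpha\chi_E|$, such that $\int_E\mathrm{div}^\alpha\varphi\,dx=-\int\varphi\cdot dD^\alpha\chi_E$ for all $\varphi\in C^\infty_c(\mathbb R^n;\mathbb R^n)$. The fractional reduced boundary $\mathscr F^\alpha E$ is the set of points $x\in\mathrm{supp}(D^\alpha\chi_E)$ such that the limit $\lim_{r\to0}\frac{D^\alpha\chi_E(B_r(x))}{|D^\alpha\chi_E|(B_r(x))}$ exists and belongs to $\mathbb S^{n-1}$. *)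

(* Defs.v *)
From HB Require Import structures.
From mathcomp Require Import all_boot all_order all_algebra.
From mathcomp Require Import all_classical all_reals all_analysis.

Set Implicit Arguments.
Unset Strict Implicit.
Unset Printing Implicit Defensive.
Import Order.TTheory GRing.Theory Num.Theory.
Import numFieldNormedType.Exports.

Local Open Scope classical_set_scope.
Local Open Scope ring_scope.

(* The library norm on ['rV[R]_n] is the sup norm: it is used below only for
   the topology, for boundedness and for derivatives, where it is equivalent to
   the Euclidean one.  Wherever the value of the norm matters, [enorm] is
   used. *)
Section euclidean.
Context {R : realType} {n : nat}.
Implicit Types x y : 'rV[R]_n.

Definition edot x y : R := \sum_(i < n) x 0 i * y 0 i.

Definition enorm x : R := Num.sqrt (edot x x).

Definition eball x (r : R) : set 'rV[R]_n := [set y | enorm (y - x) < r].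

(* The added [0] only matters for [diam set0 = 0]. *)
Definition ediam (A : set 'rV[R]_n) : \bar R :=
  ereal_sup [set d | d = 0%E \/
    exists x y, [/\ A x, A y & d = (enorm (x - y))%:E]].

End euclidean.

(* Only used for [0 < a], where the integral converges. *)
Definition Gamma {R : realType} (a : R) : R :=
  \int[@lebesgue_measure R]_(t in `]0, +oo[) (t `^ (a - 1) * expR (- t)).

Definition omega {R : realType} (s : R) : R :=
  pi `^ (s / 2) / Gamma ((s + 2) / 2).

Section hausdorff.
Context {R : realType} {n : nat}.
Local Open Scope ereal_scope.

Definition hausdorff_delta (s d : R) (A : set 'rV[R]_n) : \bar R :=
  ereal_inf [set \sum_(k <oo) ((omega s)%:E * (ediam (C k) * (2^-1)%:E) `^ s)
    | C in [set C : (set 'rV[R]_n)^nat |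
        (forall k, ediam (C k) < d%:E) /\ A `<=` \bigcup_k C k]].

(* The limit as d -> 0 is a supremum, [hausdorff_delta] being nonincreasing
   in d. *)
Definition hausdorff (s : R) (A : set 'rV[R]_n) : \bar R :=
  ereal_sup [set hausdorff_delta s d A | d in [set d | (0 < d)%R]].

End hausdorff.

Section lebesgue.
Context {R : realType} {n : nat}.
Implicit Types (a b : 'rV[R]_n) (X : set 'rV[R]_n).

Definition box a b : set 'rV[R]_n :=
  [set x | forall i, a 0 i < x 0 i <= b 0 i].

Definition box_vol a b : R := \prod_(i < n) Num.max 0 (b 0 i - a 0 i).

Local Open Scope ereal_scope.

(* Covers by countably many boxes, possibly finitely many or none. *)
Definition lebesgue_outer X : \bar R :=
  ereal_inf [set s | exists (K : set nat) (a b : nat -> 'rV[R]_n),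
    X `<=` \bigcup_(k in K) box (a k) (b k) /\
    s = \esum_(k in K) (box_vol (a k) (b k))%:E].

Let box_vol_ge0 a b : 0 <= (box_vol a b)%:E.
Proof. by rewrite lee_fin; apply: prodr_ge0 => i _; rewrite le_max lexx. Qed.

Let outer_ge0 X : 0 <= lebesgue_outer X.
Proof.
by apply: le_ereal_inf_tmp => _ [K [a [b [_ ->]]]]; apply: esum_ge0.
Qed.

Let outer0 : lebesgue_outer set0 = 0.
Proof.
apply/eqP; rewrite eq_le outer_ge0 andbT.
apply: ereal_inf_lbound; exists set0, (fun=> 0%R), (fun=> 0%R).
by split; [exact: sub0set | rewrite esum_set0].
Qed.

Let outer_le : {homo lebesgue_outer : A B / A `<=` B >-> A <= B}.
Proof.
move=> A B AB; apply: ereal_inf_le_tmp => s [K [a [b [BK sE]]]].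
by exists K, a, b; split => //; exact: subset_trans BK.
Qed.

Let outer_sigma : sigma_subadditive lebesgue_outer.
Proof.
move=> A; have [[i ioo]|] := pselect (exists i, lebesgue_outer (A i) = +oo).
  by rewrite (eseries_pinfty _ _ ioo) ?leey// => k _; rewrite -ltNye
    (lt_le_trans _ (outer_ge0 _)).
rewrite -forallNE => Aoo.
suff add2e (e : {posnum R}) : lebesgue_outer (\bigcup_k A k) <=
    \sum_(i <oo) lebesgue_outer (A i) + e%:num%:E.
  by apply/lee_addgt0Pr => _/posnumP[].
rewrite (le_trans _ (epsilon_trick _ _ _))//.
pose P k (p : set nat * (nat -> 'rV[R]_n) * (nat -> 'rV[R]_n)) :=
  A k `<=` \bigcup_(j in p.1.1) box (p.1.2 j) (p.2 j) /\
  \esum_(j in p.1.1) (box_vol (p.1.2 j) (p.2 j))%:E <=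
    lebesgue_outer (A k) + (e%:num / (2 ^ k.+1)%:R)%:E.
have [G PG] : {G : nat -> _ & forall k, P k (G k)}.
  apply: (@choice _ _ P) => k.
  have en1 : (0 < e%:num / (2 ^ k.+1)%:R :> R)%R by [].
  have /(lb_ereal_inf_adherent en1) : lebesgue_outer (A k) \is a fin_num.
    by rewrite ge0_fin_numE// lt_neqAle leey andbT; exact/eqP/Aoo.
  by move=> [_ [K [a [b [AK ->]]]] /ltW le]; exists (K, a, b).
pose I : set (nat * nat) := [set: nat] `*`` (fun k => (G k).1.1).
have /card_esym/ppcard_eqP[f] := card_nat2.
apply: (@le_trans _ _ (\esum_(p in I)
    (box_vol ((G p.1).1.2 p.2) ((G p.1).2 p.2))%:E)).
  apply: ereal_inf_lbound.
  exists (f @^-1` I), (fun j => (G (f j).1).1.2 (f j).2),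
    (fun j => (G (f j).1).2 (f j).2); split.
    move=> x [k _ /(PG k).1[j Kj xj]]; exists (f^-1%FUN (k, j)) => /=.
      by rewrite invK ?inE.
    by rewrite invK ?inE.
  rewrite (reindex_esum (f @^-1` I) I f)//.
  split; first by move=> j.
    by move=> i j _ _; apply: 'inj_f; rewrite inE.
  by move=> p Ip; exists (f^-1%FUN p) => /=; rewrite invK ?inE.
rewrite /I -(@esum_esum _ _ _ _ _
  (fun k j => (box_vol ((G k).1.2 j) ((G k).2 j))%:E))//.
rewrite -nneseries_esumT; last by move=> k; apply: esum_ge0.
by apply: lee_nneseries => k _; [move=> _; apply: esum_ge0 | exact: (PG k).2].
Qed.

HB.instance Definition _ := isOuterMeasure.Build R 'rV[R]_n lebesgue_outer
  outer0 outer_ge0 outer_le outer_sigma.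

Definition lebesgue_outer_measure : {outer_measure set 'rV[R]_n -> \bar R} :=
  lebesgue_outer.

End lebesgue.

(* [Rn R n] carries the sigma-algebra of Lebesgue measurable sets, in the sense
   of Caratheodory. *)
Notation Rn R n := (caratheodory_type (@lebesgue_outer_measure R n)).

Definition lebesgue_Rn {R : realType} {n : nat} :
  {measure set (Rn R n) -> \bar R} :=
  (@lebesgue_outer_measure R n : set (Rn R n) -> \bar R).

Notation borel_Rn R n := (g_sigma_algebraType (@open 'rV[R]_n)).

Definition borel {R : realType} {n : nat} : set (set 'rV[R]_n) :=
  @measurable _ (borel_Rn R n).

Section test_fields.
Context {R : realType} {n : nat}.
Implicit Types (phi : 'rV[R]_n -> 'rV[R]_n) (U : set 'rV[R]_n).

Fixpoint Ck (k : nat) phi : Prop :=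
  continuous phi /\
  if k is k'.+1 then
    forall i : 'I_n, (forall x, derivable phi x (delta_mx 0 i)) /\
                     Ck k' (fun x => 'D_(delta_mx 0 i) phi x)
  else True.

Definition fsupp phi : set 'rV[R]_n := closure [set x | phi x != 0].

Definition test_field U phi : Prop :=
  [/\ forall k, Ck k phi, compact (fsupp phi) & fsupp phi `<=` U].

End test_fields.

Section fractional_perimeter.
Context {R : realType} {n : nat} (alpha : R).
Implicit Types (phi : 'rV[R]_n -> 'rV[R]_n) (E : set (Rn R n))
  (U : set 'rV[R]_n).

Definition mu_const : R :=
  2 `^ alpha * pi `^ (- (n%:R / 2)) *
  Gamma ((n%:R + alpha + 1) / 2) / Gamma ((1 - alpha) / 2).

(* At [y = x] the integrand is [0], as [0^-1 = 0]. *)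
Definition fdiv phi (x : 'rV[R]_n) : R :=
  mu_const * \int[lebesgue_Rn]_y
    (edot (y - x) (phi y - phi x) / enorm (y - x) `^ (n%:R + alpha + 1)).

Definition fvar E U : \bar R :=
  ereal_sup [set (\int[lebesgue_Rn]_(x in E) fdiv phi x)%:E
    | phi in [set phi | test_field U phi /\
        ('N[lebesgue_Rn]_+oo[EFin \o enorm \o phi] <= 1)%E]].

Definition loc_finite_perimeter E : Prop :=
  measurable E /\
  forall U, open U -> bounded_set U -> (fvar E U < +oo)%E.

End fractional_perimeter.

(* An R^m-valued Radon measure on R^n is a set function on the bounded Borel
   sets; its values on other sets are irrelevant. *)
Section vector_measures.
Context {R : realType} {n m : nat}.
Implicit Types (D : set 'rV[R]_n -> 'rV[R]_m) (B : set 'rV[R]_n).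

(* Applied to [A := fun=> set0], this gives [D set0 = 0]. *)
Definition radon_vmeasure D : Prop :=
  forall A : (set 'rV[R]_n)^nat,
    (forall k, borel (A k)) -> trivIset setT A ->
    bounded_set (\bigcup_k A k) ->
    series (fun k => D (A k)) @ \oo --> D (\bigcup_k A k).

(* Total variation, for Borel [B]; [B] itself may be unbounded. *)
Definition tvar D B : \bar R :=
  ereal_sup [set (\sum_(k <oo) (enorm (D (A k)))%:E)%E
    | A in [set A : (set 'rV[R]_n)^nat |
        [/\ forall k, borel (A k) /\ bounded_set (A k),
            trivIset setT A & \bigcup_k A k = B]]].

(* Jordan decomposition of the [i]-th component of [D]. *)
Definition pos_var D (i : 'I_m) : set (borel_Rn R n) -> \bar R := fun B =>
  ereal_sup [set (D A 0 i)%:E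
    | A in [set A | [/\ borel A, bounded_set A & A `<=` B]]].

Definition neg_var D (i : 'I_m) : set (borel_Rn R n) -> \bar R :=
  pos_var (fun A => - D A) i.

Definition vintegral (phi : 'rV[R]_n -> 'rV[R]_m) D : R :=
  \sum_(i < m) fine (\int[pos_var D i]_x (phi x 0 i)%:E -
                     \int[neg_var D i]_x (phi x 0 i)%:E)%E.

Definition vsupp D : set 'rV[R]_n :=
  [set x | forall r : R, 0 < r -> (0 < tvar D (eball x r))%E].

End vector_measures.

Section fractional_gradient.
Context {R : realType} {n : nat} (alpha : R).
Implicit Types (E : set (Rn R n)) (D : set 'rV[R]_n -> 'rV[R]_n).

(* [D] is the measure D^alpha chi_E; it is determined by [E] on the bounded
   Borel sets. *)
Definition is_fgradient E D : Prop :=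
  [/\ radon_vmeasure D,
      forall U, open U -> tvar D U = fvar alpha E U &
      forall phi, test_field setT phi ->
        \int[lebesgue_Rn]_(x in E) fdiv alpha phi x = - vintegral phi D].

(* For [D] the measure D^alpha chi_E this is the reduced boundary of [E]. *)
Definition reduced_boundary D : set 'rV[R]_n :=
  [set x | vsupp D x /\
    exists2 v : 'rV[R]_n, enorm v = 1 &
      (fine (tvar D (eball x r)))^-1 *: D (eball x r) @[r --> 0^'+] --> v].

End fractional_gradient.

(* Main.v *)
(* Write mu for the total variation of the vector measure D and s = n - alpha.
   The growth bound mu (B_r(x)) <= A r^s at the points of the reduced boundary F
   gives mu <= 2^s A / omega_s H^s on F by covering F with sets of small diameter
   d, each contained in every ball of radius r > d about one of its points.  So
   everything rests on mu being concentrated on F, i.e. on Besicovitch's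
   differentiation theorem for D with respect to mu.

   For a unit vector v the defect mu - v.D is a nonnegative measure.  On a Borel
   partition (A_k) of a bounded open set which almost attains the total
   variation, with v_k the direction of D(A_k), the defects of the A_k, hence
   also those of close open supersets V_k, have a small sum.  A weak (1,1)
   maximal inequality bounds the measure of the points of V_k about which some
   small ball B has (mu - v_k.D)(B) > lambda mu(B), and
   |D(B)/mu(B) - v|^2 <= 2 (1 - v.D(B)/mu(B)) turns smallness of the relative
   defect into convergence of D(B_r(x))/mu(B_r(x)) to a unit vector.

   The maximal inequality only needs finitely many balls: comparing the defect
   of B_(r-h)(x) with mu (B_r(x)), a finite h-net of centers suffices, and the
   slack h lets balls that cover the net cover the whole set. *)
From HB Require Import structures.
Require Import Defs.
From mathcomp Require Import all_boot all_order all_algebra.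
From mathcomp Require Import all_classical all_reals all_analysis.
From mathcomp Require Import measurable_realfun ring lra.

Import Order.TTheory GRing.Theory Num.Theory.
Import numFieldNormedType.Exports.
Local Open Scope classical_set_scope.
Local Open Scope ring_scope.

(** * Euclidean norm, its balls and its topology *)

Section EuclideanNorm.
Context {R : realType} {n : nat}.
Implicit Types (x y z : 'rV[R]_n) (a r : R).

Lemma edotC x y : edot x y = edot y x.
Proof. by apply: eq_bigr => i _; rewrite mulrC. Qed.

Lemma edotDl x y z : edot (x + y) z = edot x z + edot y z.
Proof. by rewrite -big_split; apply: eq_bigr => i _; rewrite mxE mulrDl. Qed.

Lemma edotZl a x y : edot (a *: x) y = a * edot x y.
Proof. by rewrite /edot mulr_sumr; apply: eq_bigr => i _; rewrite mxE mulrA. Qed.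

Lemma edotNl x y : edot (- x) y = - edot x y.
Proof. by rewrite -scaleN1r edotZl mulN1r. Qed.

Lemma edotDr x y z : edot x (y + z) = edot x y + edot x z.
Proof. by rewrite edotC edotDl !(edotC x). Qed.

Lemma edotZr a x y : edot x (a *: y) = a * edot x y.
Proof. by rewrite edotC edotZl edotC. Qed.

Lemma edotNr x y : edot x (- y) = - edot x y.
Proof. by rewrite edotC edotNl edotC. Qed.

Lemma edot0r x : edot x 0 = 0.
Proof. by rewrite -(scale0r x) edotZr mul0r. Qed.

Lemma edot_ge0 x : 0 <= edot x x.
Proof. by apply: sumr_ge0 => i _; rewrite -expr2 sqr_ge0. Qed.

Lemma enorm_ge0 x : 0 <= enorm x.
Proof. exact: sqrtr_ge0. Qed.

Lemma sqr_enorm x : enorm x ^+ 2 = edot x x.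
Proof. by rewrite sqr_sqrtr // edot_ge0. Qed.

Lemma sqr_enormB x y :
  enorm (x - y) ^+ 2 = enorm x ^+ 2 - 2 * edot x y + enorm y ^+ 2.
Proof.
rewrite !sqr_enorm edotDl !edotDr !edotNl !edotNr (edotC y x); ring.
Qed.

Lemma enorm_eq0 x : (enorm x == 0) = (x == 0).
Proof.
apply/eqP/eqP => [x0|->]; last by rewrite /enorm edot0r sqrtr0.
have /eqP : edot x x = 0 by rewrite -sqr_enorm x0 expr0n.
rewrite psumr_eq0 => [/allP /= x00|i _]; last by rewrite -expr2 sqr_ge0.
apply/rowP => i; rewrite mxE.
have := x00 i (mem_index_enum i).
by rewrite -expr2 sqrf_eq0 => /eqP.
Qed.

Lemma enorm0 : enorm (0 : 'rV[R]_n) = 0.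
Proof. by apply/eqP; rewrite enorm_eq0. Qed.

Lemma enormZ a x : enorm (a *: x) = `|a| * enorm x.
Proof.
by rewrite /enorm edotZl edotZr mulrA -expr2 sqrtrM ?sqr_ge0// sqrtr_sqr.
Qed.

Lemma enormN x : enorm (- x) = enorm x.
Proof. by rewrite -scaleN1r enormZ normrN1 mul1r. Qed.

Lemma enormBC x y : enorm (x - y) = enorm (y - x).
Proof. by rewrite -enormN opprB. Qed.

(** Cauchy-Schwarz: expand the square of [enorm y *: x - enorm x *: y] and divide by
    [enorm x * enorm y]. *)
Lemma edot_le x y : edot x y <= enorm x * enorm y.
Proof.
have [/eqP|x0] := eqVneq (enorm x) 0.
  by rewrite enorm_eq0 => /eqP ->; rewrite edotC edot0r enorm0 mul0r.
have [/eqP|y0] := eqVneq (enorm y) 0.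
  by rewrite enorm_eq0 => /eqP ->; rewrite edot0r enorm0 mulr0.
have xy0 : 0 < enorm x * enorm y by rewrite mulr_gt0// lt0r ?x0 ?y0 enorm_ge0.
have := edot_ge0 (enorm y *: x - enorm x *: y).
rewrite -sqr_enorm sqr_enormB !enormZ edotZl edotZr.
rewrite !ger0_norm ?enorm_ge0// => h.
rewrite -(ler_pM2l xy0); nra.
Qed.

Lemma enorm_triangle x y : enorm (x + y) <= enorm x + enorm y.
Proof.
rewrite -(@ler_pXn2r _ 2) ?nnegrE ?addr_ge0 ?enorm_ge0//.
rewrite -[y in x + y]opprK sqr_enormB enormN edotNr.
by have := edot_le x y; nra.
Qed.

Lemma enorm_dist z x y : enorm (x - y) <= enorm (x - z) + enorm (z - y).
Proof. by rewrite -(subrKA z) enorm_triangle. Qed.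

Lemma enorm_sum (I : Type) (s : seq I) (P : pred I) (F : I -> 'rV[R]_n) :
  enorm (\sum_(i <- s | P i) F i) <= \sum_(i <- s | P i) enorm (F i).
Proof.
elim/big_ind2 : _ => [|x1 x2 y1 y2 h1 h2|//]; first by rewrite enorm0.
by rewrite (le_trans (enorm_triangle _ _))// lerD.
Qed.

Lemma coord_le_enorm x i : `|x 0 i| <= enorm x.
Proof.
rewrite -(@ler_pXn2r _ 2) ?nnegrE ?enorm_ge0// sqr_enorm real_normK ?num_real//.
rewrite /edot (bigD1 i)//= -expr2 lerDl.
by apply: sumr_ge0 => j _; rewrite -expr2 sqr_ge0.
Qed.

Lemma norm_le_enorm x : `|x| <= enorm x.
Proof.
rewrite [`|x|]/Num.norm/= mx_normrE; apply: bigmax_le => [|[i j] _].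
  exact: enorm_ge0.
by rewrite ord1 coord_le_enorm.
Qed.

Lemma enorm_le_norm x : enorm x <= n%:R * `|x|.
Proof.
have xi i : `|x 0 i| <= `|x|.
  by rewrite [leRHS]/Num.norm/= mx_normrE; apply: (le_bigmax _ _ (0, i)).
rewrite {1}[x]row_sum_delta (le_trans (enorm_sum _ _ _ _))//.
rewrite mulr_natl -[X in _ *+ X]card_ord -sumr_const; apply: ler_sum => i _.
rewrite enormZ -[leRHS]mulr1 ler_pM ?enorm_ge0// /enorm /edot.
rewrite (bigD1 i)//= big1 => [|j ji]; last by rewrite mxE (negPf ji) andbF mul0r.
by rewrite mxE !eqxx mulr1 addr0 sqrtr1.
Qed.

Lemma eball_subset x y r r' : enorm (y - x) + r <= r' ->
  eball y r `<=` eball x r'.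
Proof.
move=> rr' z; rewrite /eball/= => zy.
rewrite (le_lt_trans (enorm_dist y _ _))// (lt_le_trans _ rr')//.
by rewrite addrC ltrD2l.
Qed.

Lemma eball_center x r : 0 < r -> eball x r x.
Proof. by rewrite /eball/= subrr enorm0. Qed.

(** By equivalence with the sup norm, Euclidean balls generate the library topology. *)
Lemma nbhs_eball x (U : set 'rV[R]_n) :
  nbhs x U <-> exists2 r, 0 < r & eball x r `<=` U.
Proof.
split=> [/nbhs_ballP[e /= e0 eU]|[r r0 rU]].
  exists e => // y; rewrite /eball/= => ye; apply: eU.
  by rewrite -ball_normE /ball_/= distrC (le_lt_trans (norm_le_enorm _)).
(* The factor between the norms is [n]; dividing by [n.+1] keeps the divisor nonzero and the final
   inequality strict. *)
apply/nbhs_ballP; exists (r / n.+1%:R); first by rewrite /= divr_gt0.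
move=> y; rewrite -ball_normE/= distrC => yx; apply: rU; rewrite /eball/=.
rewrite (le_lt_trans (enorm_le_norm _))//.
move: yx; rewrite ltr_pdivlMr// => yx.
by rewrite (le_lt_trans _ yx)// mulrC ler_wpM2l// ler_nat.
Qed.

Lemma open_eballP (U : set 'rV[R]_n) :
  (forall x, U x -> exists2 r, 0 < r & eball x r `<=` U) -> open U.
Proof. by move=> h; rewrite openE => x /h; rewrite -nbhs_eball. Qed.

Lemma open_eball x r : open (eball x r).
Proof.
apply: open_eballP => y; rewrite /eball/= => yx.
exists (r - enorm (y - x)); first by rewrite subr_gt0.
by apply: eball_subset; rewrite addrC subrK.
Qed.

Lemma bounded_enorm (B : set 'rV[R]_n) (M : R) :
  (forall x, B x -> enorm x <= M) -> bounded_set B.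
Proof.
move=> BM; exists M; split=> [|N MN x Bx /=]; first exact: num_real.
by rewrite (le_trans (norm_le_enorm _))// (le_trans (BM _ Bx))// ltW.
Qed.

Lemma bounded_set_enorm (B : set 'rV[R]_n) : bounded_set B ->
  exists2 M, 0 < M & B `<=` eball 0 M.
Proof.
move=> [M [_ BM]].
exists (n.+1%:R * (`|M| + 1)); first by rewrite mulr_gt0// ltr_wpDl.
move=> x Bx; rewrite /eball/= subr0 (le_lt_trans (enorm_le_norm _))//.
have xM : `|x| <= `|M| + 1 by apply: BM => //; rewrite ltr_pwDr// ler_norm.
rewrite (@le_lt_trans _ _ (n%:R * (`|M| + 1))) ?ler_wpM2l//.
by rewrite ltr_pM2r ?ltr_nat// ltr_wpDl.
Qed.

Lemma bounded_eball x r : bounded_set (eball x r).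
Proof.
apply: (@bounded_enorm _ (r + enorm x)) => y; rewrite /eball/= => yx.
by rewrite -[y](subrK x) (le_trans (enorm_triangle _ _))// lerD2r ltW.
Qed.

Lemma borel_open (U : set 'rV[R]_n) : open U -> borel U.
Proof. exact: sub_sigma_algebra. Qed.

Lemma borel_eball x r : borel (eball x r).
Proof. by apply: borel_open; exact: open_eball. Qed.

End EuclideanNorm.

(** * Besicovitch selection *)

Section BesicovitchSelection.
Context {R : realType} {n : nat}.
Implicit Types (x y z : 'rV[R]_n) (h M : R) (p q : 'rV[R]_n * R)
  (s t : seq ('rV[R]_n * R)).

(** A grid of cubes of side [h / (n + 1)]: two points of one cube differ by at most the side in each
    coordinate. Choosing one point per cell yields the finite nets used below in place of
    compactness. *)
Lemma finite_cells M h : 0 < M -> 0 < h ->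
  exists (I : finType) (c : 'rV[R]_n -> I),
    forall x y, enorm x < M -> enorm y < M -> c x = c y -> enorm (x - y) < h.
Proof.
move=> M0 h0; pose e := h / n.+1%:R.
have e0 : 0 < e by rewrite divr_gt0.
pose k x i := Num.truncn ((x 0 i + M) / e).
exists {ffun 'I_n -> 'I_(Num.truncn (2 * M / e)).+1},
  (fun x => [ffun i => inord (k x i)]) => x y xM yM /ffunP xy.
(* In the ball of radius [M] the index stays within the range of the ordinal type, so [inord] does
   not change it. *)
have kP z i : enorm z < M ->
    (k z i <= Num.truncn (2 * M / e))%N /\
    (k z i)%:R * e <= z 0 i + M < (k z i).+1%:R * e.
  move=> zM; have := le_lt_trans (coord_le_enorm z i) zM.
  rewrite ltr_norml => /andP[zl zr]; split.
    by apply: le_truncn; rewrite ler_pM2r ?invr_gt0//; lra.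
  rewrite -ler_pdivlMr// -ltr_pdivrMr//; apply: truncn_itv.
  by rewrite divr_ge0 ?(ltW e0)//; lra.
apply: le_lt_trans (enorm_le_norm _) _.
have -> : h = n.+1%:R * e by rewrite mulrC divfK.
apply: (@le_lt_trans _ _ (n%:R * e)); last by rewrite ltr_pM2r// ltr_nat.
rewrite ler_wpM2l// [`|_|]/Num.norm/= mx_normrE; apply: bigmax_le => [|[i j] _].
  exact: ltW.
rewrite ord1 !mxE/=.
have [kx /andP[xl xr]] := kP x j xM; have [ky /andP[yl yr]] := kP y j yM.
have := xy j; rewrite !ffunE => /(congr1 val); rewrite /= !inordK ?ltnS// => kE.
move: xl xr; rewrite kE => xl xr; rewrite ler_norml.
by move: yr xr; rewrite -natr1 mulrDl mul1r; lra.
Qed.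

(** A ball is kept only if its center lies in no ball kept before. Earlier balls being at least as
    large, the distance between two kept centers dominates both radii. The kept balls cover all
    centers, though not all balls. *)
Lemma greedy_selection s : (forall p, p \in s -> 0 < p.2) ->
  exists t, [/\ uniq t, {subset t <= s},
    forall p, p \in s -> exists2 q, q \in t & eball q.1 q.2 p.1 &
    forall p q, p \in t -> q \in t -> p != q ->
      p.2 <= enorm (p.1 - q.1)].
Proof.
pose ge2 := [rel p q : 'rV[R]_n * R | q.2 <= p.2].
have ge2_tr : transitive ge2 by move=> p q u /= qp up; exact: le_trans up qp.
have ge2_tot : total ge2 by move=> p q /=; exact: le_total.
(* The balls are selected greedily, by nonincreasing radius. *)
move=> s0; suff [t [ut ts cov sep]] : exists t, [/\ uniq t, {subset t <= sort ge2 s},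
    forall p, p \in sort ge2 s -> exists2 q, q \in t & eball q.1 q.2 p.1 &
    forall p q, p \in t -> q \in t -> p != q -> p.2 <= enorm (p.1 - q.1)].
  exists t; split=> // [p /ts|p ps]; first by rewrite mem_sort.
  by apply: cov; rewrite mem_sort.
have : sorted ge2 (sort ge2 s) by apply: sort_sorted.
have : forall p, p \in sort ge2 s -> 0 < p.2 by move=> p; rewrite mem_sort => /s0.
elim/last_ind: (sort ge2 s) => [_ _|{s s0} s p IH s0 sp]; first by exists [::].
have [q qs||t [ut ts cov sep]] := IH.
- by apply: s0; rewrite mem_rcons inE qs orbT.
- by move: sp; rewrite -cats1 => /cat_sorted2[].
have sle q : q \in s -> p.2 <= q.2.
  move: sp; rewrite (sorted_pairwise ge2_tr) pairwise_rcons => /andP[/allP/= H _].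
  exact: H.
have [[q qt qp]|nq] := pselect (exists2 q, q \in t & eball q.1 q.2 p.1).
  exists t; split=> // [u /ts us|u]; rewrite mem_rcons inE ?us ?orbT//.
  by move=> /predU1P[->|/cov//]; exists q.
exists (p :: t); split=> /=.
- rewrite ut andbT; apply/negP => pt; apply: nq; exists p => //.
  by apply: eball_center; apply: s0; rewrite mem_rcons inE eqxx.
- by move=> u; rewrite mem_rcons !inE => /predU1P[->|/ts ->]; rewrite ?eqxx ?orbT.
- move=> u; rewrite mem_rcons inE => /predU1P[->|/cov[q qt uq]].
    exists p; rewrite ?mem_head//.
    by apply: eball_center; apply: s0; rewrite mem_rcons inE eqxx.
  by exists q; rewrite // inE qt orbT.
- have far q : q \in t -> q.2 <= enorm (p.1 - q.1).
    move=> qt; rewrite leNgt; apply/negP => qp.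
    by apply: nq; exists q.
  move=> u w; rewrite !inE => /predU1P[->|ut'] /predU1P[->|wt]; rewrite ?eqxx//.
  + by move=> _; rewrite (le_trans _ (far _ wt))// sle// ts.
  + by move=> _; rewrite enormBC far.
  + exact: sep.
Qed.

(* Seen from a point common to two balls neither of which contains the center
   of the other, the two centers make an angle of more than 60 degrees. *)
Lemma separated_directions p q z : eball p.1 p.2 z -> eball q.1 q.2 z ->
  p.2 <= enorm (p.1 - q.1) -> q.2 <= enorm (p.1 - q.1) ->
  1 < enorm ((enorm (p.1 - z))^-1 *: (p.1 - z) -
             (enorm (q.1 - z))^-1 *: (q.1 - z)).
Proof.
rewrite /eball/= !(enormBC z) => pz qz pq qp.
have := le_lt_trans (enorm_ge0 _) (lt_le_trans pz pq) => d0.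
have ap := lt_le_trans pz pq; have bq := lt_le_trans qz qp.
have := sqr_enormB (p.1 - z) (q.1 - z).
have := enorm_dist z p.1 q.1; rewrite (enormBC z).
rewrite opprB addrA subrK.
move: ap bq; set a := enorm (p.1 - z); set b := enorm (q.1 - z).
set d := enorm (p.1 - q.1); move=> ad bd dab dE.
have a0 : 0 < a by lra.
have b0 : 0 < b by lra.
rewrite -(@ltr_pXn2r _ 2) ?nnegrE ?enorm_ge0// expr1n sqr_enormB !enormZ.
rewrite edotZl edotZr -/a -/b !gtr0_norm ?invr_gt0// !mulVf ?gt_eqF//.
(* The two directions are unit vectors, so their distance exceeds 1 exactly when the cosine of their
   angle is below 1/2. By the law of cosines, as [d] exceeds both [a] and [b], twice the inner
   product is below the square of the smaller of [a] and [b], hence below [a * b]. *)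
suff : a^-1 * (b^-1 * edot (p.1 - z) (q.1 - z)) < 1 / 2 by lra.
rewrite mulrA -invfM mulrC ltr_pdivrMr ?mulr_gt0//.
have [ab|ba] := leP a b; nra.
Qed.

(** The directions from [z] to the centers of the balls containing it are pairwise more than 1
    apart, so they lie in distinct cells of diameter at most 1 of the ball of radius 2. [N] is the
    number of cells and depends only on [n]. *)
Lemma bounded_overlap : exists N : nat, forall t,
  uniq t ->
  (forall p q, p \in t -> q \in t -> p != q -> p.2 <= enorm (p.1 - q.1)) ->
  forall z, (count (fun p => z \in eball p.1 p.2) t <= N)%N.
Proof.
have [//|I [c cP]] := @finite_cells 2 1 _ ltr01.
exists #|I| => t ut sep z; rewrite -size_filter.
set u := (X in size X).
pose dir p := (enorm (p.1 - z))^-1 *: (p.1 - z).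
have dir2 p : enorm (dir p) < 2.
  rewrite enormZ ger0_norm ?invr_ge0 ?enorm_ge0//.
  (* If [z] is the center, [dir p] is 0. *)
  have [->|p0] := eqVneq (enorm (p.1 - z)) 0; first by rewrite mulr0.
  by rewrite mulVf// ltr1n.
have um : uniq (map (c \o dir) u).
  rewrite map_inj_in_uniq ?filter_uniq// => p q; rewrite !mem_filter.
  move=> /andP[/set_mem pz pt] /andP[/set_mem qz qt] /= pq.
  have [//|npq] := eqVneq p q.
  have := cP _ _ (dir2 p) (dir2 q) pq.
  rewrite ltNge ltW//; apply: separated_directions => //; first exact: sep.
  by rewrite enormBC; apply: sep => //; rewrite eq_sym.
by rewrite -(size_map (c \o dir)) -(card_uniqP um) max_card.
Qed.

End BesicovitchSelection.

(** * Total variation of a vector measure *)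

Lemma continuous_enorm {R : realType} {n : nat} : continuous (@enorm R n).
Proof.
move=> x; apply/(@cvgrPdist_lt _ _ _ (nbhs x)) => e e0.
have : nbhs x (eball x e) by apply/nbhs_eball; exists e.
apply: filterS => y; rewrite /eball/= => yx; rewrite (le_lt_trans _ yx)//.
have xy := enorm_triangle (y - x) x; have yx' := enorm_triangle (x - y) y.
rewrite subrK in xy; rewrite subrK enormBC in yx'.
by rewrite ler_norml; lra.
Qed.

Section TotalVariation.
Context {R : realType} {n m : nat} (D : set 'rV[R]_n -> 'rV[R]_m).
Hypothesis rD : radon_vmeasure D.
Implicit Types (A B : set 'rV[R]_n) (F G : (set 'rV[R]_n)^nat).

Definition tvar_partition B F :=
  [/\ forall k, borel (F k) /\ bounded_set (F k),
      trivIset setT F & \bigcup_k F k = B].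

Lemma bounded_subset A B : A `<=` B -> bounded_set B -> bounded_set A.
Proof.
move=> AB [M [Mr BM]]; exists M; split=> // N MN x /AB; exact: BM.
Qed.

(** The series with constant term [D set0] converges, so its terms tend to 0. *)
Lemma radon_vmeasure0 : D set0 = 0.
Proof.
have : series (fun=> D set0) @ \oo --> D (\bigcup_(_ in [set: nat]) set0).
  apply: rD => [k||]; first exact: measurable0.
    by apply/trivIsetP => i j _ _ _; rewrite set0I.
  rewrite bigcup0//; apply: (@bounded_enorm _ _ _ 0) => x [].
move=> h; have /cvg_series_cvg_0 : cvgn (series (fun=> D set0)) by apply/cvg_ex; eexists; exact: h.
by move=> /(cvg_unique (@norm_hausdorff _ _))/(_ (cvg_cst _)).
Qed.

Lemma radon_vmeasureU A B : borel A -> borel B -> bounded_set A ->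
  bounded_set B -> A `&` B = set0 -> D (A `|` B) = D A + D B.
Proof.
move=> mA mB bA bB AB0.
have bAB : bounded_set (A `|` B).
  have [M _ AM] := bounded_set_enorm _ bA; have [M' _ BM] := bounded_set_enorm _ bB.
  apply: (@bounded_enorm _ _ _ (Num.max M M')) => x [/AM|/BM];
    by rewrite /eball/= subr0 le_max => /ltW ->; rewrite ?orbT.
have := rD (bigcup2 A B).
rewrite bigcup2E => h.
have {}h : series (fun k => D (bigcup2 A B k)) @ \oo --> D (A `|` B).
  apply: h => //; last by rewrite -trivIset_bigcup2.
  by move=> [//|[//|k]] /=; exact: measurable0.
apply: (cvg_unique (@norm_hausdorff _ _) h).
apply: cvg_near_cst; exists 2%N => // k /= k2.
rewrite -(subnKC k2) /series/= big_nat_recl// big_nat_recl//= big1 ?addr0// => i _.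
exact: radon_vmeasure0.
Qed.

Local Open Scope ereal_scope.

Lemma enorm_sigma_subadditive F : (forall k, borel (F k)) -> trivIset setT F ->
  bounded_set (\bigcup_k F k) ->
  (enorm (D (\bigcup_k F k)))%:E <= \sum_(k <oo) (enorm (D (F k)))%:E.
Proof.
move=> mF tF bF; have h := rD _ mF tF bF.
have hh : (enorm (series (fun k => D (F k)) k))%:E @[k --> \oo] -->
    (enorm (D (\bigcup_k F k)))%:E.
  apply: cvg_EFin; first exact: nearW.
  by apply: continuous_cvg h; exact: continuous_enorm.
rewrite -(cvg_lim _ hh)//; apply: lime_le; first by apply/cvg_ex; eexists; exact: hh.
apply: nearW => k; apply: (@le_trans _ _ (\sum_(0 <= i < k) (enorm (D (F i)))%:E)).
  by rewrite sumEFin lee_fin /series/= enorm_sum.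
by apply: nneseries_lim_ge => i _ _; rewrite lee_fin enorm_ge0.
Qed.

Lemma tvar_partitionI B F A : borel A -> A `<=` B -> tvar_partition B F ->
  tvar_partition A (fun k => F k `&` A).
Proof.
move=> mA AB [mF tF FB]; split=> [k||].
- have [mFk bFk] := mF k; split; first exact: measurableI.
  by apply: bounded_subset bFk; exact: subIsetl.
- exact: trivIset_setIr.
- by rewrite -setI_bigcupl FB setIidr.
Qed.

(** The shells between balls of integer radius cut [B] into bounded pieces. *)
Lemma tvar_partition_exists B : borel B -> exists F, tvar_partition B F.
Proof.
move=> mB; exists (fun k => seqDU (fun k => eball 0 k%:R) k `&` B).
apply: (@tvar_partitionI setT) => //; split=> [k||]; last 2 first.
- exact: trivIset_seqDU.
- rewrite -seqDU_bigcup_eq; apply/seteqP; split=> // x _.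
  exists (Num.truncn (enorm x)).+1 => //.
  by rewrite /eball/= subr0 truncnS_gt.
split; last by apply: bounded_subset (bounded_eball 0 k%:R); exact: subset_seqDU.
apply: measurableD; first exact: borel_eball.
by apply: bigsetU_measurable => i _; exact: borel_eball.
Qed.

Lemma tvar_ge B F : tvar_partition B F ->
  \sum_(k <oo) (enorm (D (F k)))%:E <= tvar D B.
Proof. by move=> FB; apply: ereal_sup_ubound; exists F. Qed.

(** A bijection between [nat] and pairs merges the partitions of the pieces into one partition of
    the union. *)
Lemma tvar_partition_bigcup F (G : nat -> (set 'rV[R]_n)^nat) :
  trivIset setT F -> (forall j, tvar_partition (F j) (G j)) ->
  \sum_(j <oo) \sum_(k <oo) (enorm (D (G j k)))%:E <= tvar D (\bigcup_j F j).
Proof.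
move=> tF FG; have /card_esym/ppcard_eqP[f] := card_nat2.
have FGP j k : G j k `<=` F j.
  by have [_ _ <-] := FG j; exact: bigcup_sup.
have /tvar_ge : tvar_partition (\bigcup_j F j) (fun k => G (f k).1 (f k).2).
  split=> [k||].
  - by have [+ _ _] := FG (f k).1; exact.
  - move=> i j _ _ [x [xi xj]].
    have fij : (f i).1 = (f j).1.
      by apply: tF => //; exists x; split; apply: FGP; [exact: xi|exact: xj].
    have [_ tG _] := FG (f i).1.
    have fij2 : (f i).2 = (f j).2.
      by apply: tG => //; exists x; split => //; rewrite fij.
    have : f i = f j by rewrite [LHS]surjective_pairing fij fij2 -surjective_pairing.
    by apply: 'inj_f; rewrite inE.
  - apply/seteqP; split=> [x [k _ xk]|x [j _]].
      by exists (f k).1 => //; apply: FGP xk.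
    have [_ _ <-] := FG j => -[k _ xk]; exists (f^-1%FUN (j, k)) => //=.
    by rewrite invK ?inE.
apply: le_trans; rewrite le_eqVlt; apply/orP; left; apply/eqP.
rewrite [RHS]nneseries_esumT; last by move=> i; rewrite lee_fin enorm_ge0.
rewrite -(reindex_esum setT setT f (fun p => (enorm (D (G p.1 p.2)))%:E))//.
rewrite nneseries_esumT; last first.
  by move=> j; apply: nneseries_ge0 => k _ _; rewrite lee_fin enorm_ge0.
rewrite (@eq_esum _ _ _ _ (fun i => \esum_(k in [set: nat]) (enorm (D (G i k)))%:E)); last first.
  by move=> i _; rewrite nneseries_esumT// => k; rewrite lee_fin enorm_ge0.
rewrite esum_esum; last by move=> *; rewrite lee_fin enorm_ge0.
by congr esum; apply/seteqP; split.
Qed.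

(** For one inequality, a partition of the union is cut along the [F j] and the two sums are
    interchanged. For the other, almost optimal partitions of the [F j], with errors [e / 2 ^ j.+1],
    are merged. *)
Lemma tvar_bigcup F : (forall j, borel (F j)) -> trivIset setT F ->
  tvar D (\bigcup_j F j) = \sum_(j <oo) tvar D (F j).
Proof.
move=> mF tF; have [H Hp] := choice (fun j => tvar_partition_exists (F j) (mF j)).
have norm_ge0 B : 0 <= (enorm (D B))%:E by rewrite lee_fin enorm_ge0.
have sum_ge0 (G : (set 'rV[R]_n)^nat) : 0 <= \sum_(k <oo) (enorm (D (G k)))%:E.
  by apply: nneseries_ge0.
have tvar_ge0 B : borel B -> 0 <= tvar D B.
  by move=> mB; have [G /tvar_ge] := tvar_partition_exists B mB; exact: le_trans.
apply/eqP; rewrite eq_le; apply/andP; split.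
  apply: ge_ereal_sup => _ [G [bG tG GF] <-].
  apply: (@le_trans _ _ (\sum_(k <oo) \sum_(j <oo) (enorm (D (G k `&` F j)))%:E)).
    apply: lee_nneseries => // k _.
    rewrite -{1}(setIidl (_ : G k `<=` \bigcup_j F j)); last first.
      by rewrite -GF; exact: bigcup_sup.
    rewrite setI_bigcupr; apply: enorm_sigma_subadditive.
    - by move=> j; apply: measurableI; [exact: (bG k).1|exact: mF].
    - exact: trivIset_setIl.
    - rewrite -setI_bigcupr; have [_] := bG k.
      by apply: bounded_subset; exact: subIsetl.
  rewrite nneseries_interchange//; apply: lee_nneseries => // j _.
  apply: tvar_ge; apply: (tvar_partitionI (\bigcup_j F j)) => //.
  exact: bigcup_sup.
(* Almost optimal partitions exist only where the variation is finite. If some [F j] has infinite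
   variation, each of its partitions is completed by arbitrary partitions [H i] of the other
   pieces. *)
have [[j joo]|nj] := pselect (exists j, tvar D (F j) = +oo).
  suff -> : tvar D (\bigcup_j F j) = +oo by rewrite leey.
  apply/eqP; rewrite -leye_eq -joo; apply: ge_ereal_sup => _ [G Gj <-].
  apply: le_trans (tvar_partition_bigcup F (fun i => if i == j then G else H i) tF _).
    2: by move=> i; have [->|//] := eqVneq i j; exact: Gj.
  rewrite [leRHS](@nneseriesD1 _ _ j)//=.
  by rewrite eqxx leeDl// nneseries_ge0.
have Ffin j : tvar D (F j) \is a fin_num.
  rewrite ge0_fin_numE ?tvar_ge0// ltey; apply/eqP => joo; apply: nj.
  by exists j.
apply/lee_addgt0Pr => e e0.
have /choice[G GP] : forall j, exists G, tvar_partition (F j) G /\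
    tvar D (F j) <= \sum_(k <oo) (enorm (D (G k)))%:E + (e / (2 ^ j.+1)%:R)%:E.
  move=> j; have ej : (0 < e / (2 ^ j.+1)%:R)%R by rewrite divr_gt0// ltr0n expn_gt0.
  have [_ [G Gj <-] lt] := ub_ereal_sup_adherent ej (Ffin j).
  by exists G; split => //; rewrite -leeBlDr// ltW.
apply: (@le_trans _ _ (\sum_(j <oo) (\sum_(k <oo) (enorm (D (G j k)))%:E +
    (e / (2 ^ j.+1)%:R)%:E))).
  by apply: lee_nneseries => [j _ _|j _]; [apply: tvar_ge0; exact: mF|have [] := GP j].
apply: le_trans (epsilon_trick xpredT _ (ltW e0)) _ => //.
rewrite leeD2r//; by apply: tvar_partition_bigcup => // j; have [] := GP j.
Qed.

Lemma tvar0 : tvar D set0 = 0.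
Proof.
apply/eqP; rewrite eq_le; apply/andP; split.
  apply: ge_ereal_sup => _ [G [_ _ G0] <-].
  rewrite eseries0// => k _ _; suff -> : G k = set0 by rewrite radon_vmeasure0 enorm0.
  by apply/seteqP; split=> // x Gkx; rewrite -G0; exists k.
have [|G /tvar_ge] := tvar_partition_exists set0; first exact: measurable0.
by apply: le_trans; apply: nneseries_ge0 => k _ _; rewrite lee_fin enorm_ge0.
Qed.

Lemma enorm_le_tvar B : borel B -> bounded_set B ->
  (enorm (D B))%:E <= tvar D B.
Proof.
move=> mB bB.
have /tvar_ge : tvar_partition B (fun k => if k is 0%N then B else set0).
  split=> [[|k]||].
  - by [].
  - split; first exact: measurable0.
    by apply: bounded_subset bB.
  - by move=> [|i] [|j] _ _ [x []].
  - by apply/seteqP; split=> [x [[|k] _]//|x Bx]; exists 0%N.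
apply: le_trans; rewrite [leRHS](@nneseriesD1 _ _ 0%N)//=; last first.
  by move=> k _; rewrite lee_fin enorm_ge0.
by rewrite leeDl// nneseries_ge0// => k _ _; rewrite lee_fin enorm_ge0.
Qed.

(* [tvar D] is [-oo] on sets without a Borel partition, hence the [maxe]. *)
Definition tvar_measure of radon_vmeasure D : set (borel_Rn R n) -> \bar R :=
  fun B => maxe 0 (tvar D B).

Lemma tvar_measureE B : borel B ->
  tvar_measure rD B = tvar D B.
Proof.
move=> mB; apply/max_idPr; have [G /tvar_ge] := tvar_partition_exists B mB.
by apply: le_trans; apply: nneseries_ge0 => k _ _; rewrite lee_fin enorm_ge0.
Qed.

Let tvar_measure0 : tvar_measure rD set0 = 0.
Proof. by rewrite /tvar_measure tvar0 maxxx. Qed.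

Let tvar_measure_ge0 B : 0 <= tvar_measure rD B.
Proof. by rewrite le_max lexx. Qed.

Let tvar_measure_sigma_additive : semi_sigma_additive (tvar_measure rD).
Proof.
move=> F mF tF mUF; rewrite tvar_measureE// tvar_bigcup//.
under eq_eseriesr do rewrite -(tvar_measureE _ (mF _)).
exact: is_cvg_nneseries.
Qed.

HB.instance Definition _ := isMeasure.Build _ _ _ (tvar_measure rD)
  tvar_measure0 tvar_measure_ge0 tvar_measure_sigma_additive.

End TotalVariation.

Definition tvar_meas {R : realType} {n m : nat} {D : set 'rV[R]_n -> 'rV[R]_m}
  (h : radon_vmeasure D) : {measure set (borel_Rn R n) -> \bar R} :=
  tvar_measure D h.

(** Induction on [s], cutting [C] along the first set: inside it the remaining sets overlap at most
    [N - 1] times, outside it at most [N] times. The argument rests on finite additivity and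
    positivity within [U], so it applies to the real-valued defect. *)
Lemma sum_overlap_le {d} {T : algebraOfSetsType d} {R : realType} (I : eqType)
    (tau : set T -> R) (F : I -> set T) (s : seq I) (N : nat) (U C : set T) :
  (forall A, measurable A -> A `<=` U -> 0 <= tau A) ->
  (forall A B, measurable A -> measurable B -> A `<=` U -> B `<=` U ->
    A `&` B = set0 -> tau (A `|` B) = tau A + tau B) ->
  (forall i, i \in s -> measurable (F i)) ->
  measurable C -> C `<=` U ->
  (forall z, C z -> (count (fun i => z \in F i) s <= N)%N) ->
  \sum_(i <- s) tau (F i `&` C) <= N%:R * tau C.
Proof.
move=> tau_ge0 tauU; elim: s N C => [|i s IH] N C mF mC CU CN.
  by rewrite big_nil mulr_ge0// tau_ge0.
have mFs j : j \in s -> measurable (F j) by move=> js; apply: mF; rewrite inE js orbT.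
have mFi : measurable (F i) by apply: mF; rewrite mem_head.
have splitC B : measurable B -> tau (B `&` C) =
    tau (B `&` (C `&` F i)) + tau (B `&` (C `\` F i)).
  move=> mB; rewrite -tauU ?setDE -?setIUr -?setIUr ?setUv ?setIT//.
  - by do 2 apply: measurableI => //.
  - by apply: measurableI => //; apply: measurableI => //; exact: measurableC.
  - by apply: subset_trans CU => x [_ []].
  - by apply: subset_trans CU => x [_ []].
  - by rewrite -setDE; apply/seteqP; split=> x// [[_ [_ ?]] [_ [_ ?]]].
have tC : tau C = tau (C `&` F i) + tau (C `\` F i).
  by rewrite -[in LHS](setTI C) splitC ?setTI//; exact: measurableT.
have mCF : measurable (C `&` F i) by exact: measurableI.
have mCD : measurable (C `\` F i) by exact: measurableD.
have CFU : C `&` F i `<=` U by apply: subset_trans CU; exact: subIsetl.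
have CDU : C `\` F i `<=` U by apply: subset_trans CU; exact: subDsetl.
have tau0 : tau set0 = 0.
  have := tauU set0 set0 measurable0 measurable0 (sub0set _) (sub0set _).
  by rewrite setU0 setI0 => /(_ erefl) /eqP; rewrite -subr_eq subrr => /eqP.
rewrite big_cons (setIC (F i)) (eq_big_seq (fun j => tau (F j `&` (C `&` F i)) +
    tau (F j `&` (C `\` F i)))); last by move=> j /mFs/splitC.
rewrite big_split/= tC mulrDr addrA lerD//; last first.
  apply: IH => // z [Cz nFz]; apply: leq_trans (CN z Cz) => /=.
  exact: leq_addl.
(* Only a point of [C] in [F i] forces [N] to be positive. *)
have [C0|/set0P[z0 [Cz0 Fz0]]] := eqVneq (C `&` F i) set0.
  rewrite C0 tau0 mulr0 add0r big1// => j _.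
  by rewrite setI0.
case: N CN => [|N] CN.
  by have := CN z0 Cz0; rewrite /= mem_set.
rewrite -natr1 mulrDl mul1r addrC lerD//; apply: IH => // z [Cz Fz].
by have := CN z Cz; rewrite /= mem_set.
Qed.

(** * Continuity of measures along sequences of sets *)

Section Measures.
Context {d} {T : measurableType d} {R : realType}.
Variable mu : {measure set T -> \bar R}.
Local Open Scope ereal_scope.

Lemma measure_le (A B : set T) : measurable A -> measurable B -> A `<=` B ->
  mu A <= mu B.
Proof. by move=> mA mB; apply: le_measure; rewrite inE. Qed.

Lemma bigcap_set0_small (F : (set T)^nat) (e : R) : (0 < e)%R ->
  mu (F 0%N) < +oo -> (forall k, measurable (F k)) -> nonincreasing_seq F ->
  \bigcap_k F k = set0 -> exists k, mu (F k) < e%:E.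
Proof.
move=> e0 F0 mF niF capF; apply: contrapT => nF.
have := @nonincreasing_cvg_mu _ _ _ mu F F0 mF.
rewrite capF measure0 => /(_ measurable0 niF) h.
have : e%:E <= lim (mu \o F @ \oo).
  apply: lime_ge; first by apply/cvg_ex; eexists; exact: h.
  by apply: nearW => k; rewrite leNgt; apply/negP => ?; apply: nF; exists k.
by rewrite (cvg_lim _ h)// lee_fin leNgt e0.
Qed.

Lemma bigcup_lt_measure (F : (set T)^nat) (y : \bar R) :
  (forall k, measurable (F k)) -> nondecreasing_seq F ->
  y < mu (\bigcup_k F k) -> exists k, y < mu (F k).
Proof.
move=> mF ndF yF; apply: contrapT => nF; move: yF; rewrite ltNge => /negP; apply.
have h := @nondecreasing_cvg_mu _ _ _ mu F mF (bigcup_measurable (fun k _ => mF k)) ndF.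
rewrite -(cvg_lim _ h)//; apply: lime_le; first by apply/cvg_ex; eexists; exact: h.
by apply: nearW => k; rewrite leNgt; apply/negP => ?; apply: nF; exists k.
Qed.

(** [W] is the lower limit of the [O k]: as [S] increases, [S k] lies in every [O j] with [k <= j].
    This replaces continuity from below for sets [S k] not known to be measurable. *)
Lemma bigcup_measurable_cover (S O : (set T)^nat) (c : \bar R) :
  nondecreasing_seq S -> (forall k, measurable (O k)) ->
  (forall k, S k `<=` O k) -> (forall k, mu (O k) <= c) ->
  exists2 W, measurable W & \bigcup_k S k `<=` W /\ mu W <= c.
Proof.
move=> ndS mO SO Oc; pose V k := \bigcap_(j in [set j | (k <= j)%N]) O j.
have mV k : measurable (V k) by apply: bigcap_measurableType => j _; exact: mO.
have ndV : nondecreasing_seq V.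
  move=> i j ij; apply/subsetPset => x Vx k /= jk.
  by apply: Vx => /=; exact: leq_trans jk.
exists (\bigcup_k V k); first exact: bigcup_measurable.
split.
  apply: subset_bigcup => k _ x Skx j /= kj; apply: SO.
  by have /subsetPset := ndS _ _ kj; apply.
rewrite leNgt; apply/negP => /(bigcup_lt_measure _ _ mV ndV)[k].
apply/negP; rewrite -leNgt; apply: le_trans (Oc k).
by apply: measure_le => // x; apply => /=.
Qed.

End Measures.

(** * Approximation of Borel sets by closed and open sets *)

Section OuterRegularity.
Context {R : realType} {n : nat}.
Local Open Scope ereal_scope.
Implicit Types (mu : {measure set (borel_Rn R n) -> \bar R}).

Lemma borel_closed (C : set 'rV[R]_n) : closed C -> borel C.
Proof.
move=> cC; rewrite -[C]setCK; apply: measurableC.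
by apply: borel_open; exact: closed_openC.
Qed.

Lemma finite_borel_regular mu : mu setT < +oo -> forall A, borel A ->
  forall e : R, (0 < e)%R -> exists C U : set 'rV[R]_n,
    [/\ closed C, open U, C `<=` A, A `<=` U & mu (U `\` C) <= e%:E].
Proof.
move=> muT; have mufin B : borel B -> mu B < +oo.
  by move=> mB; apply: le_lt_trans muT; apply: measure_le => //; exact: measurableT.
apply: smallest_sub; last first.
  move=> U oU e e0.
  (* The points at distance at least [1 / (k + 1)] from the complement: closed sets increasing to
     [U]. *)
  pose F k : set 'rV[R]_n := [set x | forall y, ~ U y -> (k.+1%:R^-1 <= enorm (y - x))%R].
  have cF k : closed (F k).
    rewrite -openC; apply: open_eballP => x /existsNP[y /not_implyP[Uy /negP]].
    rewrite -ltNge => yx; exists (k.+1%:R^-1 - enorm (y - x))%R; first by rewrite subr_gt0.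
    move=> z; rewrite /eball/= => zx /(_ y Uy); apply/negP; rewrite -ltNge.
    by rewrite (le_lt_trans (enorm_dist x _ _))// (enormBC x) -ltrBrDl.
  have mUF k : borel (U `\` F k).
    by apply: measurableD; [exact: borel_open|exact: borel_closed].
  have [||||k /ltW ek] := @bigcap_set0_small _ _ _ mu (fun k => U `\` F k) e e0.
  - exact: mufin.
  - exact: mUF.
  - move=> i j ij; apply/subsetPset; apply: setDS => x Fx y Uy.
    by apply: le_trans (Fx y Uy); rewrite lef_pV2 ?posrE// ler_nat ltnS.
  - apply/seteqP; split=> // x UF; have [Ux _] := UF 0%N I.
    have /nbhs_eball[r r0 rU] : nbhs x U by exact: open_nbhs_nbhs.
    have [k _ kr] := near_infty_natSinv_lt (PosNum r0).
    have [_] := UF k I; apply => y Uy; rewrite leNgt; apply/negP => yx.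
    apply: Uy; apply: rU; by apply: lt_trans yx _; apply: (kr k) => /=.
  - exists (F k), U; split=> // x Fx; apply: contrapT => /(Fx x).
    by rewrite subrr enorm0 leNgt invr_gt0 ltr0n.
split.
- move=> e e0; exists set0, set0; split=> //; first exact: closed0.
  by rewrite setD0 measure0 lee_fin ltW.
- move=> A Areg e e0; have [C [U [cC oU CA AU UC]]] := Areg e e0.
  exists (~` U), (~` C); split.
  + exact: open_closedC.
  + exact: closed_openC.
  + by rewrite setTD; apply: subsetC.
  + by rewrite setTD; apply: subsetC.
  + by rewrite setDE setCK setIC -setDE.
- move=> A Areg e e0; have e20 : (0 < e / 2)%R by rewrite divr_gt0.
  have /choice[CU CUP] : forall k, exists CU : set 'rV[R]_n * set 'rV[R]_n,
    [/\ closed CU.1, open CU.2, CU.1 `<=` A k, A k `<=` CU.2 &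
        mu (CU.2 `\` CU.1) <= (e / 2 / (2 ^ k.+1)%:R)%:E].
    move=> k; have [|C [U CU]] := Areg k (e / 2 / (2 ^ k.+1)%:R)%R.
      by rewrite divr_gt0// ltr0n expn_gt0.
    by exists (C, U).
  pose U := \bigcup_k (CU k).2.
  pose C k := \bigcup_(i < k.+1) (CU i).1.
  have cC k : closed (C k).
    by apply: closed_bigcup => [|i _]; [exact: finite_II|have [] := CUP i].
  have oU : open U by apply: bigcup_open => i _; have [] := CUP i.
  have mUC i : borel ((CU i).2 `\` (CU i).1).
    have [cCi oUi _ _ _] := CUP i.
    by apply: measurableD; [exact: borel_open|exact: borel_closed].
  (* Half of [e] pays for [V], the errors of the individual sets; the other half pays for keeping
     finitely many of the closed sets, since an infinite union need not be closed. *)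
  pose V := \bigcup_k ((CU k).2 `\` (CU k).1).
  have mV : borel V by apply: bigcup_measurable => k _; exact: mUC.
  have Ve : mu V <= (e / 2)%:E.
    apply: (@le_trans _ _ (\sum_(k <oo) (e / 2 / (2 ^ k.+1)%:R)%:E)).
      apply: (@le_trans _ _ (\sum_(k <oo) mu ((CU k).2 `\` (CU k).1))).
        exact: measure_sigma_subadditive.
      by apply: lee_nneseries => // k _; have [] := CUP k.
    by apply: epsilon_trick0; exact: ltW.
  have mF k : borel ((U `\` V) `\` C k).
    apply: measurableD; last exact: borel_closed.
    by apply: measurableD => //; exact: borel_open.
  have [||||k /ltW ek] := @bigcap_set0_small _ _ _ mu (fun k => (U `\` V) `\` C k) _ e20.
  - exact: mufin.
  - exact: mF.
  - move=> i j ij; apply/subsetPset; apply: setDS; apply: bigcup_sub => k /= ki.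
    by move=> x Cx; exists k => //=; exact: leq_trans ki _.
  - apply/seteqP; split=> // x h; have [[[k _ Ux] nV] _] := h 0%N I.
    have [_] := h k I; apply; exists k; first exact: ltnSn.
    by apply: contrapT => nC; apply: nV; exists k.
  exists (C k), U; split=> //.
  + by move=> x [i _ Cx]; exists i => //; have [_ _ + _ _] := CUP i; exact.
  + by move=> x [i _ Cx]; exists i => //; have [_ _ _ + _] := CUP i; exact.
  + apply: (@le_trans _ _ (mu (V `|` ((U `\` V) `\` C k)))).
      apply: measure_le.
      * by apply: measurableD; [exact: borel_open|exact: borel_closed].
      * by apply: measurableU => //; exact: mF.
      * by move=> x [Ux nC]; have [|nV] := pselect (V x); [left|right].
    apply: le_trans (measureU2 mu mV (mF k)) _.
    by rewrite [e in leRHS]splitr EFinD leeD.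
Qed.

(** The finite case, applied to the restriction of [mu] to [U0]. *)
Lemma borel_outer_regular mu (U0 A : set 'rV[R]_n) (e : R) :
  open U0 -> mu U0 < +oo -> borel A -> A `<=` U0 -> (0 < e)%R ->
  exists U, [/\ open U, A `<=` U, U `<=` U0 & mu (U `\` A) <= e%:E].
Proof.
move=> oU0 muU0 mA AU0 e0; have mU0 := borel_open _ oU0.
have [|C [U [cC oU CA AU UC]]] := finite_borel_regular (mrestr mu mU0) _ A mA e e0.
  by rewrite /= /mrestr setTI.
exists (U `&` U0); split.
- exact: openI.
- by move=> x Ax; split; [exact: AU|exact: AU0].
- exact: subIsetr.
- apply: le_trans UC; rewrite /= /mrestr; apply: measure_le.
  + by apply: measurableD => //; apply: measurableI => //; exact: borel_open.
  + apply: measurableI => //.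
    by apply: measurableD; [exact: borel_open|exact: borel_closed].
  + by move=> x [[Ux U0x] nA]; split => //; split => // /CA.
Qed.

End OuterRegularity.

(** * Maximal inequality and differentiation *)

Section MaximalInequality.
Context {R : realType} {n m : nat} (D : set 'rV[R]_n -> 'rV[R]_m).
Hypothesis rD : radon_vmeasure D.
Hypothesis finD : forall B, borel B -> bounded_set B -> (tvar D B < +oo)%E.
Implicit Types (A B U : set 'rV[R]_n) (v : 'rV[R]_m).

Let mu : {measure set (borel_Rn R n) -> \bar R} := tvar_meas rD.

Lemma tvar_measE B : borel B -> mu B = tvar D B.
Proof. exact: tvar_measureE. Qed.

Lemma fin_num_mu B : borel B -> bounded_set B -> mu B \is a fin_num.
Proof. by move=> mB bB; rewrite ge0_fin_numE// tvar_measE// finD. Qed.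

Lemma fineK_mu B : borel B -> bounded_set B -> (fine (mu B))%:E = mu B.
Proof. by move=> mB bB; rewrite fineK// fin_num_mu. Qed.

Definition defect v B : R := fine (mu B) - edot v (D B).

Lemma abs_edot_le_mu v B : enorm v <= 1 -> borel B -> bounded_set B ->
  `|edot v (D B)| <= fine (mu B).
Proof.
move=> v1 mB bB.
have DB : enorm (D B) <= fine (mu B).
  by rewrite -lee_fin fineK_mu// tvar_measE// enorm_le_tvar.
apply: le_trans DB; rewrite ler_norml.
have := edot_le v (D B); have := edot_le (- v) (D B).
rewrite edotNl enormN; have := enorm_ge0 (D B); have := enorm_ge0 v.
nra.
Qed.

Lemma defect_ge0 v B : enorm v <= 1 -> borel B -> bounded_set B ->
  0 <= defect v B.
Proof.
move=> v1 mB bB; have := abs_edot_le_mu v B v1 mB bB.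
by rewrite ler_norml subr_ge0 => /andP[].
Qed.

Lemma defect_le v B : enorm v <= 1 -> borel B -> bounded_set B ->
  defect v B <= 2 * fine (mu B).
Proof.
move=> v1 mB bB; have := abs_edot_le_mu v B v1 mB bB.
by rewrite /defect ler_norml; lra.
Qed.

Lemma defectU v A B : borel A -> borel B -> bounded_set A -> bounded_set B ->
  A `&` B = set0 -> defect v (A `|` B) = defect v A + defect v B.
Proof.
move=> mA mB bA bB AB; rewrite /defect radon_vmeasureU// edotDr.
rewrite measureU//.
rewrite fineD ?fin_num_mu//; ring.
Qed.

Lemma defect0 v : defect v set0 = 0.
Proof. by rewrite /defect measure0 radon_vmeasure0// edot0r subr0. Qed.

Lemma defectD v A B : borel A -> borel B -> bounded_set B -> A `<=` B ->
  defect v B = defect v A + defect v (B `\` A).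
Proof.
move=> mA mB bB AB; rewrite -[in LHS](setDUK AB) defectU//.
- exact: measurableD.
- exact: bounded_subset bB.
- by apply: bounded_subset bB; exact: subDsetl.
- exact: setDIK.
Qed.

Lemma le_defect v A B : enorm v <= 1 -> borel A -> borel B -> bounded_set B ->
  A `<=` B -> defect v A <= defect v B.
Proof.
move=> v1 mA mB bB AB; rewrite (defectD v A B)// lerDl defect_ge0//.
  exact: measurableD.
by apply: bounded_subset bB; exact: subDsetl.
Qed.

Lemma measure_bigsetU_le (I : eqType) (s : seq I) (F : I -> set 'rV[R]_n) :
  (forall i, i \in s -> borel (F i)) ->
  (mu (\big[setU/set0]_(i <- s) F i) <= \sum_(i <- s) mu (F i))%E.
Proof.
elim: s => [|i s IH] mF; first by rewrite !big_nil measure0.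
have mFs j : j \in s -> borel (F j) by move=> js; apply: mF; rewrite inE js orbT.
rewrite !big_cons; apply: le_trans (measureU2 _ _ _) _.
- by apply: mF; rewrite mem_head.
- by rewrite big_seq; apply: bigsetU_measurable => j; exact: mFs.
- by rewrite leeD2l// IH.
Qed.

(** The slack between the ball carrying the defect and the ball whose measure is estimated. *)
Let h (k : nat) : R := k.+1%:R^-1.

Let h_gt0 k : 0 < h k. Proof. by rewrite invr_gt0. Qed.

Let le_h i j : (i <= j)%N -> h j <= h i.
Proof. by move=> ij; rewrite lef_pV2 ?posrE// ler_nat ltnS. Qed.

(** Each enlarged ball has measure at most [lam^-1] times the defect of the selected ball inside it,
    and the selected balls overlap at most [N] times within [U]. The bound is independent of [k]. *)
Let small_balls_cover (N : nat) U v (lam : R) (k : nat) :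
  (forall t : seq ('rV[R]_n * R), uniq t ->
  (forall p q, p \in t -> q \in t -> p != q -> p.2 <= enorm (p.1 - q.1)) ->
  forall z, (count (fun p => z \in eball p.1 p.2) t <= N)%N) ->
  open U -> bounded_set U -> enorm v <= 1 -> 0 < lam ->
  exists O : set 'rV[R]_n, [/\ borel O,
    [set x | U x /\ exists r, [/\ h k < r, eball x r `<=` U &
      lam * fine (mu (eball x r)) < defect v (eball x (r - h k))]] `<=` O &
    (mu O <= (N%:R / lam * defect v U)%:E)%E].
Proof.
move=> NP oU bU v1 lam0.
set S := [set x | U x /\ exists r, [/\ h k < r, eball x r `<=` U &
      lam * fine (mu (eball x r)) < defect v (eball x (r - h k))]].
have mU := borel_open _ oU.
have [M M0 UM] := bounded_set_enorm _ bU.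
have [I [c cP]] := @finite_cells R n M (h k) M0 (h_gt0 k).
pose Q (p : 'rV[R]_n * R) := [/\ h k < p.2, eball p.1 p.2 `<=` U &
      lam * fine (mu (eball p.1 p.2)) < defect v (eball p.1 (p.2 - h k))].
(* One admissible ball per cell meeting [S]; the value [(0, 0)] elsewhere is arbitrary. *)
have /choice[g gP] : forall j, exists p, (exists x, S x /\ c x = j) ->
    [/\ U p.1, Q p & c p.1 = j].
  move=> j.
  have [[x [[Ux [r rP]] cx]]|nj] := pselect (exists x, S x /\ c x = j).
    by exists (x, r) => _; split.
  by exists (0, 0) => /nj.
pose J := [seq j <- enum I | `[< exists x, S x /\ c x = j >]].
(* The selection runs on the shrunk balls. Adding [h k] back to the radii covers [S], each point of
   which is within [h k] of the representative of its cell. *)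
pose s := [seq ((g j).1, (g j).2 - h k) | j <- J].
have sP p : p \in s -> [/\ 0 < p.2, eball p.1 (p.2 + h k) `<=` U &
      lam * fine (mu (eball p.1 (p.2 + h k))) < defect v (eball p.1 p.2)].
  move=> /mapP[j]; rewrite mem_filter => /andP[/asboolP/gP[_ [g1 g2 g3] _] _] ->/=.
  by rewrite subrK subr_gt0.
have [|t [ut ts tcov tsep]] := greedy_selection s; first by move=> p /sP[].
have tP p : p \in t -> [/\ 0 < p.2, eball p.1 (p.2 + h k) `<=` U &
      lam * fine (mu (eball p.1 (p.2 + h k))) < defect v (eball p.1 p.2)].
  by move=> /ts/sP.
exists (\big[setU/set0]_(q <- t) eball q.1 (q.2 + h k)); split.
- by apply: bigsetU_measurable => q _; exact: borel_eball.
- move=> x Sx; have [|Ug [g1 g2 g3] cg] := gP (c x); first by exists x.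
  have [|q qt gq] := tcov ((g (c x)).1, (g (c x)).2 - h k).
    apply/mapP; exists (c x) => //.
    by rewrite mem_filter mem_enum andbT; apply/asboolP; exists x.
  rewrite -bigcup_seq; exists q => //.
  rewrite /eball/= (le_lt_trans (enorm_dist (g (c x)).1 _ _))// addrC ltrD//.
  have := UM _ Sx.1; have := UM _ Ug; rewrite /eball/= !subr0 => gM xM.
  exact: cP.
- apply: le_trans (measure_bigsetU_le _ _ _ _) _ => [q _|]; first exact: borel_eball.
  apply: (@le_trans _ _ (\sum_(q <- t) (lam^-1 * defect v (eball q.1 q.2))%:E)%E).
    rewrite big_seq [leRHS]big_seq; apply: lee_sum => q /tP[_ _ q3].
    rewrite -fineK_mu ?lee_fin; [|exact: borel_eball|exact: bounded_eball].
    by rewrite mulrC ler_pdivlMr// mulrC ltW.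
  rewrite sumEFin lee_fin -mulr_sumr mulrAC mulrC ler_pM2r ?invr_gt0//.
  rewrite (eq_big_seq (fun q => defect v (eball q.1 q.2 `&` U))); last first.
    move=> q /tP[_ q2 _]; rewrite setIidl//; apply: subset_trans q2.
    by apply: eball_subset; rewrite subrr enorm0 add0r lerDl ltW.
  apply: (@sum_overlap_le _ (borel_Rn R n) _ _ _ _ _ _ U) => //.
  + move=> A mA AU; apply: defect_ge0 => //; exact: bounded_subset bU.
  + move=> A B mA mB AU BU; apply: defectU => //; exact: bounded_subset bU.
  + by move=> q _; exact: borel_eball.
  + by move=> z _; exact: NP.
Qed.

(** An open ball is the increasing union of its concentric shrunk balls, so the strict inequality
    survives a small slack: the set is the increasing union of the sets treated by
    [small_balls_cover]. *)
Lemma defect_maximal_inequality : exists N : nat, forall U v (lam : R),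
  open U -> bounded_set U -> enorm v <= 1 -> 0 < lam ->
  exists2 W : set 'rV[R]_n, borel W &
    [set x | U x /\ exists r, [/\ 0 < r, eball x r `<=` U &
      lam * fine (mu (eball x r)) < defect v (eball x r)]] `<=` W /\
    (mu W <= (N%:R / lam * defect v U)%:E)%E.
Proof.
have [N NP] := @bounded_overlap R n; exists N => U v lam oU bU v1 lam0.
pose S k := [set x | U x /\ exists r, [/\ h k < r, eball x r `<=` U &
      lam * fine (mu (eball x r)) < defect v (eball x (r - h k))]].
have [V VP] := choice (fun k => small_balls_cover N U v lam k NP oU bU v1 lam0).
have [||||W mW [SW Wle]] := @bigcup_measurable_cover _ (borel_Rn R n) _ mu S V
  (N%:R / lam * defect v U)%:E.
- move=> i j ij; apply/subsetPset => x [Ux [r [r1 r2 r3]]]; split=> //.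
  exists r; split=> //; first exact: le_lt_trans (le_h _ _ ij) r1.
  apply: lt_le_trans r3 _; apply: le_defect => //; try exact: borel_eball.
    exact: bounded_eball.
  by apply: eball_subset; rewrite subrr enorm0 add0r lerB// le_h.
- by move=> k; have [] := VP k.
- by move=> k; have [_ + _] := VP k.
- by move=> k; have [_ _ +] := VP k.
exists W => //; split=> //; apply: subset_trans SW => x [Ux [r [r0 rU rlt]]].
have mb y r' : borel (eball y r' : set 'rV[R]_n) by exact: borel_eball.
have bb y r' : bounded_set (eball y r' : set 'rV[R]_n) by exact: bounded_eball.
pose F k := eball x r `\` eball x (r - h k).
have sub_h k : eball x (r - h k) `<=` eball x r.
  by apply: eball_subset; rewrite subrr enorm0 add0r gerBl ltW.
have bF k : bounded_set (F k) by apply: bounded_subset (bb x r); exact: subDsetl.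
have mF k : borel (F k) by apply: measurableD; exact: mb.
(* Half of the gap, since the defect of the removed shell [F k] is at most twice its measure. *)
have e0 : 0 < (defect v (eball x r) - lam * fine (mu (eball x r))) / 2.
  by rewrite divr_gt0// subr_gt0.
have [||||k ek] := @bigcap_set0_small _ (borel_Rn R n) _ mu F _ e0.
- by rewrite tvar_measE// finD.
- by [].
- move=> i j ij; apply/subsetPset; apply: setDS; apply: eball_subset.
  by rewrite subrr enorm0 add0r lerB// le_h.
- apply/seteqP; split=> // y Fy; have [yr _] := Fy 0%N I.
  have d0 : 0 < r - enorm (y - x) by rewrite subr_gt0.
  have [k _ kr] := near_infty_natSinv_lt (PosNum d0).
  have [_] := Fy k I; apply; rewrite /eball/=.
  by rewrite ltrBrDr addrC -ltrBrDr; apply: (kr k) => /=.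
exists k => //; split=> //.
have kgt : lam * fine (mu (eball x r)) < defect v (eball x (r - h k)).
  have := defectD v _ _ (mb x (r - h k)) (mb x r) (bb x r) (sub_h k).
  have := defect_le v (F k) v1 (mF k) (bF k).
  have {}ek : fine (mu (F k)) <
      (defect v (eball x r) - lam * fine (mu (eball x r))) / 2.
    by rewrite -lte_fin fineK_mu.
  rewrite -/(F k); lra.
(* If [r <= h k] the shrunk ball is empty and has no defect, against [kgt]. *)
exists r; split=> //; rewrite ltNge; apply/negP => rh.
move: kgt; suff -> : eball x (r - h k) = set0.
  by rewrite defect0 ltNge mulr_ge0 ?(ltW lam0)// fine_ge0.
apply/seteqP; split=> // y; rewrite /eball/= => yr.
by have := enorm_ge0 (y - x); lra.
Qed.

End MaximalInequality.

(** The vector [v] may vary with [e]: the hypothesis makes [f @ F] a Cauchy filter, and its limit is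
    a unit vector by continuity of the norm. *)
Lemma cvg_to_unit_vector {R : realType} {m : nat} {T : Type}
    (F : set_system T) (FF : ProperFilter F) (f : T -> 'rV[R]_m) :
  (forall e : R, 0 < e -> exists2 v, enorm v = 1 &
    \forall r \near F, enorm (f r - v) < e) ->
  exists2 v, enorm v = 1 & f @ F --> v.
Proof.
move=> H; have /cauchy_cvg cf : cauchy (f @ F).
  apply: cauchy_exP => e e0; have [v v1 fv] := H e e0; exists v.
  rewrite /fmap/=; near=> r; rewrite /= -ball_normE /= distrC.
  by apply: le_lt_trans (norm_le_enorm _) _; near: r.
exists (lim (f @ F)); last exact: cf.
have cn : enorm (f r) @[r --> F] --> enorm (lim (f @ F)).
  by apply: continuous_cvg cf; exact: continuous_enorm.
apply: (cvg_unique (@Rhausdorff R) cn).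
apply/cvgrPdist_lt => e e0; have [v v1 fv] := H e e0; near=> r.
rewrite -v1 -[X in X < _]/(`|enorm v - enorm (f r)|).
have fr : enorm (f r - v) < e by near: r.
have a := enorm_triangle (f r - v) v; have b := enorm_triangle (v - f r) (f r).
rewrite !subrK in a b; rewrite (enormBC v) in b.
by rewrite ltr_norml; lra.
Unshelve. all: by end_near. Qed.

(** * Differentiation of a vector measure by its total variation *)

Section Differentiation.
Context {R : realType} {n m : nat} (D : set 'rV[R]_n -> 'rV[R]_m).
Hypothesis rD : radon_vmeasure D.
Hypothesis finD : forall B, borel B -> bounded_set B -> (tvar D B < +oo)%E.
Hypothesis m_gt0 : (0 < m)%N.

Let mu : {measure set (borel_Rn R n) -> \bar R} := tvar_meas rD.

Lemma unit_vector_along (w : 'rV[R]_m) :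
  exists2 v, enorm v = 1 & edot v w = enorm w.
Proof.
have [->|w0] := eqVneq w 0.
  exists (delta_mx 0 (Ordinal m_gt0)); last by rewrite edot0r enorm0.
  rewrite /enorm /edot (bigD1 (Ordinal m_gt0))//= big1 => [|j ji].
    by rewrite !mxE !eqxx mulr1 addr0 sqrtr1.
  by rewrite !mxE (negPf ji) andbF mul0r.
have nw0 : enorm w != 0 by rewrite enorm_eq0.
exists ((enorm w)^-1 *: w).
  by rewrite enormZ ger0_norm ?invr_ge0 ?enorm_ge0// mulVf.
by rewrite edotZl -sqr_enorm expr2 mulrA mulVf// mul1r.
Qed.

(** The exceptional set: off it, a single unit vector keeps the relative defect of all small balls
    below [lam] or equal to it. *)
Definition non_aligned (lam : R) : set 'rV[R]_n :=
  [set x | forall v, enorm v = 1 -> forall d, 0 < d ->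
    exists r, [/\ 0 < r, r < d &
      lam * fine (mu (eball x r)) < defect D rD v (eball x r)]].

Lemma non_aligned_small (lam e : R) (U0 : set 'rV[R]_n) : 0 < lam -> 0 < e ->
  open U0 -> bounded_set U0 -> exists W : set 'rV[R]_n,
  [/\ borel W, non_aligned lam `&` U0 `<=` W & (mu W <= e%:E)%E].
Proof.
move=> lam0 e0 oU0 bU0; have mU0 := borel_open _ oU0.
have [N HN] := defect_maximal_inequality D rD finD.
(* The defects of the [A k] add up to at most [e1], those of the [V k] minus [A k] to at most
   [2 * e1]. Multiplied by [N / lam], the total [3 * e1] becomes [e * N / (N + 1)]. *)
pose e1 := e * lam / (3 * N.+1%:R).
have e10 : 0 < e1 by rewrite !mulr_gt0// invr_gt0 mulr_gt0.
have finU0 : tvar D U0 \is a fin_num.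
  by rewrite -(tvar_measE D rD)// fin_num_mu.
have [_ [A Apart <-] ltA] := ub_ereal_sup_adherent e10 finU0.
have [mbA tA AU0] := Apart.
have AU k : A k `<=` U0 by rewrite -AU0; exact: bigcup_sup.
have mA k : borel (A k) by have [] := mbA k.
have bA k : bounded_set (A k) by have [] := mbA k.
have /choice[V VP] : forall k, exists V, [/\ open V, A k `<=` V, V `<=` U0 &
    (mu (V `\` A k) <= (e1 / (2 ^ k.+1)%:R)%:E)%E].
  move=> k; apply: borel_outer_regular => //.
    by rewrite tvar_measE// finD.
  by rewrite divr_gt0// ltr0n expn_gt0.
have /choice[v vP] : forall k, exists v, enorm v = 1 /\
    edot v (D (A k)) = enorm (D (A k)).
  by move=> k; have [v] := unit_vector_along (D (A k)); exists v.
have bV k : bounded_set (V k) by have [_ _ + _] := VP k; move=> /bounded_subset; apply.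
have mV k : borel (V k) by have [oV _ _ _] := VP k; exact: borel_open.
have mVA k : borel (V k `\` A k) by apply: measurableD; [exact: mV|exact: mA].
have bVA k : bounded_set (V k `\` A k) by apply: bounded_subset (bV k); exact: subDsetl.
have v_le1 k : enorm (v k) <= 1 by have [->] := vP k.
have /choice[W WP] : forall k, exists W : set 'rV[R]_n, [/\ borel W,
    [set x | V k x /\ exists r, [/\ 0 < r, eball x r `<=` V k &
      lam * fine (mu (eball x r)) < defect D rD (v k) (eball x r)]] `<=` W &
    (mu W <= (N%:R / lam * defect D rD (v k) (V k))%:E)%E].
  move=> k; have [oV _ _ _] := VP k.
  by have [W mW [SW Wle]] := HN (V k) (v k) lam oV (bV k) (v_le1 k) lam0; exists W.
have mW k : borel (W k) by have [] := WP k.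
exists (\bigcup_k W k); split.
- by apply: bigcup_measurable => k _; exact: mW.
- move=> x [nx]; rewrite -AU0 => -[k _ Akx]; exists k => //.
  have [_ SW _] := WP k; apply: SW; have [oV AV _ _] := VP k.
  have Vx := AV _ Akx; split=> //.
  have /nbhs_eball[d d0 dV] : nbhs x (V k) by exact: open_nbhs_nbhs.
  (* Non-alignment is tested against the direction [v k] of the piece containing [x], at radii whose
     balls stay in [V k]. *)
  have [r [r0 rd rlt]] := nx (v k) (vP k).1 d d0; exists r; split=> //.
  by apply: subset_trans dV; apply: eball_subset; rewrite subrr enorm0 add0r ltW.
pose dA k := fine (mu (A k)) - enorm (D (A k)).
have dA_ge0 k : 0 <= dA k.
  by rewrite subr_ge0 -lee_fin fineK_mu// tvar_measE// enorm_le_tvar.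
have dA_sum : (\sum_(k <oo) (dA k)%:E <= e1%:E)%E.
  have sumA : (\sum_(k <oo) (enorm (D (A k)))%:E \is a fin_num)%E.
    rewrite ge0_fin_numE; last by apply: nneseries_ge0 => k _ _; rewrite lee_fin enorm_ge0.
    by apply: le_lt_trans (tvar_ge D _ _ Apart) _; exact: finD.
  rewrite -(leeD2rE _ _ sumA) -nneseriesD; last 2 first.
  - by move=> k _ _; rewrite lee_fin.
  - by move=> k _ _; rewrite lee_fin enorm_ge0.
  under eq_eseriesr do rewrite -EFinD /dA subrK fineK_mu//.
  rewrite -measure_semi_bigcup//; last by apply: bigcup_measurable => k _; exact: mA.
  by rewrite AU0 tvar_measE// -leeBlDl// ltW.
apply: (@le_trans _ _ (\sum_(k <oo) ((N%:R / lam)%:E *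
    ((dA k)%:E + (2 * (e1 / (2 ^ k.+1)%:R))%:E)))%E).
  apply: (@le_trans _ _ (\sum_(k <oo) mu (W k))%E).
    by apply: measure_sigma_subadditive => //; apply: bigcup_measurable => k _; exact: mW.
  apply: lee_nneseries => [k _ _|k _]; first exact: measure_ge0.
  have [_ _ Wle] := WP k; apply: le_trans Wle _.
  rewrite -EFinD -EFinM lee_fin ler_wpM2l ?divr_ge0 ?(ltW lam0)//.
  have [_ AV _ VA] := VP k.
  (* By the choice of [v k], the defect of [A k] is exactly [dA k]; that of the rest of [V k] is at
     most twice its measure. *)
  rewrite (defectD D rD finD (v k) (A k) (V k))// {1}/defect (vP k).2 lerD2l.
  apply: le_trans (defect_le D rD finD (v k) (V k `\` A k) _ _ _) _ => //.
  by rewrite ler_pM2l// -lee_fin fineK_mu.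
rewrite nneseriesZl; last first.
  by move=> k _; rewrite adde_ge0 ?lee_fin// mulr_ge0// divr_ge0// ltW.
rewrite nneseriesD; last 2 first.
- by move=> k _ _; rewrite lee_fin.
- by move=> k _ _; rewrite lee_fin mulr_ge0// divr_ge0 ?(ltW e10).
under [X in (_ * (_ + X))%E]eq_eseriesr do rewrite mulrA.
apply: (@le_trans _ _ ((N%:R / lam)%:E * (e1%:E + (2 * e1)%:E))%E).
  rewrite lee_wpmul2l ?lee_fin ?divr_ge0 ?(ltW lam0)// leeD//.
  by apply: epsilon_trick0; rewrite mulr_ge0// ltW.
rewrite -EFinD -EFinM lee_fin /e1.
have -> : N%:R / lam * (e * lam / (3 * N.+1%:R) + 2 * (e * lam / (3 * N.+1%:R))) =
  e * (N%:R / N.+1%:R).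
  move: (N.+1%:R : R) (ltr0Sn R N) => S S0; field.
  by rewrite ?gt_eqF.
by rewrite ler_piMr ?(ltW e0)// ler_pdivrMr// mul1r ler_nat.
Qed.

Lemma negligible_small (A : set 'rV[R]_n) :
  (forall e : R, 0 < e -> exists W : set 'rV[R]_n,
     [/\ borel W, A `<=` W & (mu W <= e%:E)%E]) -> mu.-negligible A.
Proof.
move=> H; have /choice[W WP] : forall k : nat, exists W : set 'rV[R]_n,
     [/\ borel W, A `<=` W & (mu W <= (k.+1%:R^-1)%:E)%E].
  by move=> k; apply: H; rewrite invr_gt0.
have mW k : borel (W k) by have [] := WP k.
exists (\bigcap_k W k); split.
- by apply: bigcap_measurableType => k _; exact: mW.
- apply/eqP; rewrite eq_le measure_ge0 andbT; apply/lee_addgt0Pr => e e0.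
  have [k _ ke] := near_infty_natSinv_lt (PosNum e0).
  rewrite add0e; apply: (@le_trans _ _ (mu (W k))).
    apply: measure_le; [|exact: mW|by move=> x Wx; apply: (Wx k)].
    by apply: bigcap_measurableType => i _; exact: mW.
  have [_ _ Wk] := WP k; apply: le_trans Wk _; rewrite lee_fin ltW//.
  exact: (ke k (leqnn k)).
- by move=> x Ax k _; have [_ + _] := WP k; exact.
Qed.

Lemma negligible_non_aligned (lam : R) : 0 < lam -> mu.-negligible (non_aligned lam).
Proof.
move=> lam0.
apply: (@negligibleS _ (borel_Rn R n) _ mu (\bigcup_k (non_aligned lam `&` eball 0 k%:R))).
  move=> x nx; exists (Num.truncn (enorm x)).+1 => //; split=> //.
  by rewrite /eball/= subr0 truncnS_gt.
apply: negligible_bigcup => k; apply: negligible_small => e e0.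
by apply: non_aligned_small => //; [exact: open_eball|exact: bounded_eball].
Qed.

(** A point off the support is the center of a null ball of radius [1 / (k + 1)] for some [k]. In a
    bounded region, for fixed [k], one such ball per cell of smaller diameter covers all these
    points. *)
Lemma negligible_setC_vsupp : mu.-negligible (~` vsupp D).
Proof.
pose X (k j : nat) : set 'rV[R]_n :=
  [set x | enorm x < j.+1%:R /\ mu (eball x k.+1%:R^-1) = 0%E].
apply: (@negligibleS _ (borel_Rn R n) _ mu (\bigcup_k \bigcup_j X k j)).
  move=> x /existsNP[r /not_implyP[r0 /negP]]; rewrite -leNgt => tr0.
  have [k _ kr] := near_infty_natSinv_lt (PosNum r0).
  exists k => //; exists (Num.truncn (enorm x)) => //; split.
    exact: truncnS_gt.
  apply/eqP; rewrite eq_le measure_ge0 andbT; apply: le_trans tr0.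
  rewrite -(tvar_measE D rD); last exact: borel_eball.
  apply: measure_le; try exact: borel_eball.
  apply: eball_subset; rewrite subrr enorm0 add0r ltW//; exact: (kr k (leqnn k)).
apply: negligible_bigcup => k; apply: negligible_bigcup => j.
have h0 : 0 < k.+1%:R^-1 :> R by rewrite invr_gt0.
have j0 : 0 < j.+1%:R :> R by [].
have [I [c cP]] := @finite_cells R n j.+1%:R k.+1%:R^-1 j0 h0.
have /choice[g gP] : forall i, exists x, (exists y, X k j y /\ c y = i) ->
    X k j x /\ c x = i.
  move=> i; have [[y yP]|ni] := pselect (exists y, X k j y /\ c y = i).
    by exists y.
  by exists 0 => /ni.
pose J := [seq i <- enum I | `[< exists y, X k j y /\ c y = i >]].
exists (\big[setU/set0]_(i <- J) eball (g i) k.+1%:R^-1); split.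
- by apply: bigsetU_measurable => i _; exact: borel_eball.
- apply/eqP; rewrite eq_le measure_ge0 andbT.
  apply: le_trans (measure_bigsetU_le D rD _ _ _ _) _ => [i _|]; first exact: borel_eball.
  rewrite big_seq big1// => i; rewrite mem_filter => /andP[/asboolP/gP[[_ //]] _].
- move=> x Xx; have exx : exists y, X k j y /\ c y = c x by exists x.
  have [[gj _] cg] := gP (c x) exx.
  rewrite -bigcup_seq; exists (c x); last by apply: cP => //; exact: Xx.1.
  by rewrite /= mem_filter mem_enum andbT; apply/asboolP.
Qed.

End Differentiation.

Lemma negligible_setC_reduced_boundary {R : realType} {n : nat}
    (D : set 'rV[R]_n -> 'rV[R]_n) (rD : radon_vmeasure D) :
  (0 < n)%N ->
  (forall B, borel B -> bounded_set B -> (tvar D B < +oo)%E) ->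
  (tvar_meas rD).-negligible (~` reduced_boundary D).
Proof.
move=> n_gt0 finD; set mu := tvar_meas rD.
apply: (@negligibleS _ (borel_Rn R n) _ mu (~` vsupp D `|`
    \bigcup_k (non_aligned D rD k.+1%:R^-1))); last first.
  apply: negligibleU; first exact: negligible_setC_vsupp.
  apply: negligible_bigcup => k; apply: negligible_non_aligned => //.
move=> x; apply: contra_notP => /not_orP[/contrapT sx nx]; split=> //.
apply: cvg_to_unit_vector => e e0.
(* With relative defect at most [q], the squared distance from the normalized [D (eball x r)] to [v]
   is at most [2 * q]; hence the threshold [e ^+ 2 / 2]. Being in the support makes the
   normalization meaningful. *)
have e20 : 0 < e ^+ 2 / 2 by rewrite divr_gt0// exprn_gt0.
have [k _ ke] := near_infty_natSinv_lt (PosNum e20).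
have : ~ non_aligned D rD k.+1%:R^-1 x by move=> xk; apply: nx; exists k.
move=> /existsNP[v /not_implyP[v1 /existsNP[d /not_implyP[d0 Hd]]]].
exists v => //; near=> r.
have r0 : 0 < r by near: r; exact: nbhs_right_gt.
have rd : r < d by near: r; exact: nbhs_right_lt.
have mr : borel (eball x r : set 'rV[R]_n) by exact: borel_eball.
have br : bounded_set (eball x r : set 'rV[R]_n) by exact: bounded_eball.
have := sx r r0; rewrite -(tvar_measE D rD)// -/mu -(fineK_mu D rD finD)// lte_fin.
have : enorm (D (eball x r)) <= fine (mu (eball x r)).
  by rewrite -lee_fin fineK_mu// tvar_measE// enorm_le_tvar.
have : defect D rD v (eball x r) <= k.+1%:R^-1 * fine (mu (eball x r)).
  by rewrite leNgt; apply/negP => h; apply: Hd; exists r.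
have : k.+1%:R^-1 < e ^+ 2 / 2 by exact: (ke k (leqnn k)).
rewrite /defect -/mu; set q := k.+1%:R^-1; set a := fine _ => qe da nD a0.
rewrite -(@ltr_pXn2r _ 2) ?nnegrE ?enorm_ge0 ?(ltW e0)// sqr_enormB v1 enormZ.
rewrite edotZl (edotC _ v) gtr0_norm ?invr_gt0//.
have b1 : a^-1 * enorm (D (eball x r)) <= 1 by rewrite mulrC ler_pdivrMr// mul1r.
have b0 : 0 <= a^-1 * enorm (D (eball x r)).
  by rewrite mulr_ge0 ?invr_ge0 ?(ltW a0) ?enorm_ge0.
have : 1 - q <= a^-1 * edot v (D (eball x r)).
  by rewrite mulrC ler_pdivlMr//; lra.
nra.
Unshelve. all: by end_near. Qed.

(** * Comparison with the Hausdorff measure *)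

Section GammaPositive.
Context {R : realType}.

(** Exponentiate [p] times the inequality [ln u <= u] at [u = t / (2 * p)]. *)
Lemma powR_le_expR (p t : R) : 0 < p -> 0 < t ->
  t `^ p <= expR (p * ln (2 * p)) * expR (t / 2).
Proof.
move=> p0 t0; rewrite /powR gt_eqF// -expRD ler_expR.
have tp : 0 < t / (2 * p) by rewrite divr_gt0// mulr_gt0.
have := ltW (ln_sublinear tp); rewrite ln_div ?posrE ?mulr_gt0//.
move=> /(ler_wpM2l (ltW p0)).
have -> : p * (t / (2 * p)) = t / 2 by field; rewrite gt_eqF.
by rewrite mulrBr lerBlDl.
Qed.

(** The real integral is the [fine] part of an extended one, which is 0 at infinity, so finiteness
    is needed as well. The integrand is at least [expR (- 2)] on the interval from 1 to 2, and is
    dominated by a multiple of the exponential density of rate 1/2. *)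
Lemma Gamma_gt0 (a : R) : 1 < a -> 0 < Gamma a.
Proof.
move=> a1; have p0 : 0 < a - 1 by rewrite subr_gt0.
pose f (t : R) := t `^ (a - 1) * expR (- t).
have f_ge0 t : 0 <= f t by rewrite mulr_ge0 ?powR_ge0 ?expR_ge0.
have mf : measurable_fun [set: R] f.
  apply: measurable_funM; first exact: measurable_powR.
  by apply: measurableT_comp; [exact: measurable_expR|exact: oppr_measurable].
have mEf (D : set R) : measurable_fun D (EFin \o f).
  by apply/measurable_EFinP; apply: measurable_funS mf.
have mD : measurable (`]0, +oo[%classic : set R) by exact: measurable_itv.
rewrite /Gamma /Rintegral -/(f _); apply: fine_gt0; apply/andP; split.
- apply: (@lt_le_trans _ _ (\int[lebesgue_measure]_(t in `[1%R, 2%R]) (expR (- 2))%:E)%E).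
    rewrite integral_cst//= lebesgue_measure_itv/= lte_fin ltr1n/=.
    by rewrite -EFinB -EFinM lte_fin mulr_gt0 ?expR_gt0// subr_gt0 ltr1n.
  apply: (@le_trans _ _ (\int[lebesgue_measure]_(t in `[1%R, 2%R]) (f t)%:E)%E).
    apply: ge0_le_integral.
    - exact: measurable_itv.
    - by move=> t _; rewrite lee_fin expR_ge0.
    - exact: measurable_cst.
    - exact: mEf.
    - move=> t /=; rewrite in_itv/= => /andP[t1 t2]; rewrite lee_fin -[leLHS]mul1r.
      rewrite ler_pM ?expR_ge0// ?ler_expR ?lerN2//.
      apply: (@le_trans _ _ (1 `^ (a - 1))); first by rewrite powR1.
      by rewrite ge0_ler_powR ?nnegrE ?(ltW p0)// (le_trans _ t1).
  apply: ge0_subset_integral => //; first exact: mEf.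
    by move=> t _; rewrite lee_fin; exact: f_ge0.
  move=> t /=; rewrite !in_itv/= andbT => /andP[t1 _].
  exact: lt_le_trans t1.
- have h0 : 0 < 2^-1 :> R by [].
  (* The factor 2 cancels the rate 1/2 in front of the density. *)
  pose C : R := expR ((a - 1) * ln (2 * (a - 1))) * 2.
  have C0 : 0 <= C by rewrite mulr_ge0 ?expR_ge0.
  apply: (@le_lt_trans _ _ (\int[lebesgue_measure]_t (C%:E * (exponential_pdf 2^-1 t)%:E))%E).
    apply: (@le_trans _ _ (\int[lebesgue_measure]_(t in `]0%R, +oo[) (C%:E * (exponential_pdf 2^-1 t)%:E))%E).
      apply: ge0_le_integral; first exact: mD.
      + by move=> t _; rewrite lee_fin; exact: f_ge0.
      + exact: mEf.
      + apply: measurable_funeM; apply/measurable_EFinP.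
        by apply: measurable_funS (measurable_exponential_pdf _).
      + move=> t /=; rewrite in_itv/= andbT => t0; rewrite -EFinM lee_fin.
        rewrite exponential_pdfE ?(ltW t0)// /C -!mulrA mulVKf// /f.
        have -> : expR (- t) = expR (- (t / 2)) * expR (- 2^-1 * t).
          by rewrite -expRD; congr expR; field.
        rewrite mulrA ler_pM2r ?expR_gt0// expRN ler_pdivrMr ?expR_gt0//.
        exact: powR_le_expR.
    apply: ge0_subset_integral => //.
    + apply: measurable_funeM; apply/measurable_EFinP.
      exact: measurable_exponential_pdf.
    + by move=> t _; rewrite mule_ge0// lee_fin ?exponential_pdf_ge0.
  rewrite ge0_integralZl//=.
  + by rewrite integral_exponential_pdf// mule1 ltry.
  + by apply/measurable_EFinP; exact: measurable_exponential_pdf.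
  + by move=> t _; rewrite lee_fin exponential_pdf_ge0.
Qed.

Lemma omega_gt0 (s : R) : 0 < s -> 0 < omega s.
Proof.
move=> s0; rewrite /omega divr_gt0 ?powR_gt0 ?pi_gt0//.
by apply: Gamma_gt0; rewrite ltr_pdivlMr// mul1r ltrDr.
Qed.

End GammaPositive.

(** * Covering estimate under a growth bound *)

Section HausdorffComparison.
Context {R : realType} {n : nat}.
Variable mu : {measure set (borel_Rn R n) -> \bar R}.
Variables (A s : R).
Hypotheses (A_gt0 : 0 < A) (s_gt0 : 0 < s) (omega_gt0 : 0 < omega s).
Implicit Types (B E K : set 'rV[R]_n).
Local Open Scope ereal_scope.

Definition growth_set (d : R) : set 'rV[R]_n :=
  [set x | forall r, (0 < r)%R -> (r < d)%R -> mu (eball x r) <= (A * r `^ s)%:E].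

(** A violation at [x] with radius [r] persists on a slightly smaller ball about [x], which lies in
    the ball of radius [r] about any [y] close to [x]. Closedness provides measurability. *)
Lemma closed_growth_set (d : R) : closed (growth_set d).
Proof.
rewrite -openC; apply: open_eballP => x /existsNP[r /not_implyP[r0]].
move=> /not_implyP[rd /negP]; rewrite -ltNge => rx.
have rU : \bigcup_k eball x (r - k.+1%:R^-1) = eball x r.
  apply/seteqP; split=> [y [k _]|y yr].
    apply: eball_subset; rewrite subrr enorm0 add0r gerBl.
    by rewrite invr_ge0.
  have d0 : (0 < r - enorm (y - x))%R by rewrite subr_gt0.
  have [k _ kr] := near_infty_natSinv_lt (PosNum d0).
  exists k => //; rewrite /eball/= ltrBrDr addrC -ltrBrDr.
  exact: (kr k (leqnn k)).
have [|||k kx] := @bigcup_lt_measure _ (borel_Rn R n) _ mu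
  (fun k => eball x (r - k.+1%:R^-1)) (A * r `^ s)%:E.
- by move=> k; exact: borel_eball.
- move=> i j ij; apply/subsetPset; apply: eball_subset.
  by rewrite subrr enorm0 add0r lerB// lef_pV2 ?posrE// ler_nat ltnS.
- by rewrite rU.
exists k.+1%:R^-1%R; first by rewrite invr_gt0.
move=> y; rewrite /eball/= => yx /(_ r r0 rd); apply/negP; rewrite -ltNge.
apply: lt_le_trans kx _; apply: measure_le; try exact: borel_eball.
by apply: eball_subset; rewrite enormBC addrC -lerBrDr lerB// ltW.
Qed.

Lemma ediam_ge0 B : 0 <= ediam B.
Proof. by apply: ereal_sup_ubound; left. Qed.

Lemma enorm_le_ediam B x y : B x -> B y -> (enorm (x - y))%:E <= ediam B.
Proof. by move=> Bx By; apply: ereal_sup_ubound; right; exists x, y. Qed.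

(** [E] is a closed ball about a point of [K] in [B], with radius the diameter of [B]. The Hausdorff
    measure uses half the diameter instead: this is the origin of the factor [2 ^ s]. *)
Lemma growth_set_cell (d : R) B K : (0 < d)%R -> ediam B < d%:E ->
  K `<=` growth_set d ->
  exists E, [/\ borel E, K `&` B `<=` E &
    mu E <= (A * (fine (ediam B)) `^ s)%:E].
Proof.
move=> d0 Bd KG; set del := fine (ediam B).
have del0 : (0 <= del)%R by rewrite fine_ge0// ediam_ge0.
have dfin : ediam B = del%:E.
  by rewrite fineK// ge0_fin_numE ?ediam_ge0// (lt_trans Bd)// ltry.
have deld : (del < d)%R by rewrite -lte_fin -dfin.
have [->|/set0P[x [Kx Bx]]] := eqVneq (K `&` B) set0.
  exists set0; split=> //; first exact: measurable0.
  by rewrite measure0 lee_fin mulr_ge0 ?powR_ge0// ltW.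
have mE : borel [set y : 'rV[R]_n | (enorm (y - x) <= del)%R].
  apply: borel_closed; rewrite -openC; apply: open_eballP => y /= /negP.
  rewrite -ltNge => yx; exists (enorm (y - x) - del)%R; first by rewrite subr_gt0.
  move=> z; rewrite /eball/= => zy; apply/negP; rewrite -ltNge.
  by have := enorm_dist z y x; rewrite (enormBC y z); lra.
exists [set y | (enorm (y - x) <= del)%R]; split => //.
  by move=> y [Ky By] /=; rewrite -lee_fin -dfin; exact: enorm_le_ediam.
have Erho (rho : R) : (del < rho)%R -> (rho < d)%R ->
    mu [set y | (enorm (y - x) <= del)%R] <= (A * rho `^ s)%:E.
  move=> h1 h2; apply: (@le_trans _ _ (mu (eball x rho))).
    apply: measure_le => //; first exact: borel_eball.
    by move=> y /= yx; rewrite /eball/= (le_lt_trans yx).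
  by apply: KG => //; exact: le_lt_trans h1.
have Efin : mu [set y | (enorm (y - x) <= del)%R] \is a fin_num.
  rewrite ge0_fin_numE//; apply: le_lt_trans (Erho ((del + d) / 2)%R _ _) _.
  - by lra.
  - by lra.
  - by rewrite ltry.
move: Erho; rewrite -(fineK Efin); set e := fine _ => Erho.
rewrite lee_fin leNgt; apply/negP => Ae.
have e0 : (0 < e / A)%R.
  by rewrite divr_gt0//; apply: le_lt_trans Ae; rewrite mulr_ge0 ?powR_ge0// ltW.
(* The radius at which the growth bound equals the measure [e] of the closed ball. If [e] were too
   large, a radius strictly between [del] and both [rho0] and [d] would contradict [Erho]. *)
pose rho0 := ((e / A) `^ s^-1)%R.
have rho0s : (rho0 `^ s = e / A)%R.
  by rewrite -powRrM mulVf ?gt_eqF// powRr1// ltW.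
have drho0 : (del < rho0)%R.
  rewrite ltNge; apply/negP => h.
  have : (rho0 `^ s <= del `^ s)%R.
    by apply: ge0_ler_powR; rewrite ?nnegrE ?powR_ge0 ?(ltW s_gt0).
  by rewrite rho0s ler_pdivrMr// mulrC leNgt Ae.
pose rho := ((del + Num.min rho0 d) / 2)%R.
have mlt : (del < Num.min rho0 d)%R by rewrite lt_min drho0.
have rho1 : (rho < Num.min rho0 d)%R by rewrite /rho; lra.
have : (del < rho)%R by rewrite /rho; lra.
move: rho1; rewrite lt_min => /andP[r1 r2] r3.
have := Erho rho r3 r2; rewrite lee_fin; apply/negP; rewrite -ltNge.
rewrite mulrC -ltr_pdivlMr// -rho0s; apply: gt0_ltr_powR => //.
  by rewrite nnegrE; apply: le_trans (ltW r3).
by rewrite nnegrE powR_ge0.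
Qed.

(** Every cover of [B] by sets of diameter below [d] covers [K], and its sets may be replaced by the
    Borel sets of [growth_set_cell]. So the bound holds already for [hausdorff_delta] at scale
    [d]. *)
Lemma le_hausdorff_growth (d : R) B K : (0 < d)%R -> borel K ->
  K `<=` growth_set d -> K `<=` B ->
  mu K <= (2 `^ s * (A / omega s))%:E * hausdorff s B.
Proof.
move=> d0 mK KG KB; set c := (2 `^ s * (A / omega s))%R.
have c0 : (0 < c)%R by rewrite mulr_gt0 ?powR_gt0// divr_gt0.
rewrite -lee_pdivrMl//; apply: (@le_trans _ _ (hausdorff_delta s d B)); last first.
  by apply: ereal_sup_ubound; exists d.
apply: le_ereal_inf_tmp => _ [C [Cd BC] <-]; rewrite lee_pdivrMl//.
have dn k : ediam (C k) = (fine (ediam (C k)))%:E.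
  by rewrite fineK// ge0_fin_numE ?ediam_ge0// (lt_trans (Cd k))// ltry.
have /choice[E EP] : forall k, exists E, [/\ borel E, K `&` C k `<=` E &
    mu E <= (A * (fine (ediam (C k))) `^ s)%:E].
  by move=> k; exact: (growth_set_cell d).
have mE k : borel (E k) by have [] := EP k.
rewrite -nneseriesZl; last first.
  by move=> k _; rewrite mule_ge0 ?poweR_ge0// lee_fin ltW.
apply: (@le_trans _ _ (\sum_(k <oo) mu (E k))).
  apply: measure_sigma_subadditive; [exact: mE|exact: mK|].
  move=> x Kx; have [k _ Ckx] := BC _ (KB _ Kx); exists k => //.
  by have [_ + _] := EP k; apply.
apply: lee_nneseries => [k _ _|k _]; first exact: measure_ge0.
have [_ _ Ek] := EP k; apply: le_trans Ek _.
have -> : ediam (C k) * (2^-1)%:E = (fine (ediam (C k)) / 2)%:E.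
  by rewrite {1}dn EFinM.
rewrite poweR_EFin -!EFinM lee_fin powRM ?fine_ge0 ?ediam_ge0//.
rewrite le_eqVlt; apply/orP; left; apply/eqP; rewrite /= /c.
have h2 : (2 `^ s * 2^-1 `^ s = 1 :> R)%R.
  by rewrite -powRM// divff// powR1.
move: h2; set u := (2 `^ s)%R; set v := (2^-1 `^ s)%R => uv.
set w := (_ `^ s)%R.
have -> : (u * (A / omega s) * (omega s * (w * v)) = (u * v) * (A / omega s * omega s) * w)%R by ring.
by rewrite uv divfK ?gt_eqF// mul1r.
Qed.

End HausdorffComparison.

(** * Estimate of the fractional perimeter on the reduced boundary *)

Theorem corollary5p4 (R : realType) (n : nat) (alpha A : R) :
  (0 < n)%N -> 0 < alpha -> alpha < 1 -> 0 < A ->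
  (forall (E : set (Rn R n)) (D : set 'rV[R]_n -> 'rV[R]_n),
    loc_finite_perimeter alpha E -> is_fgradient alpha E D ->
    forall x, reduced_boundary D x ->
    exists2 rx : R, 0 < rx & forall r : R, 0 < r -> r < rx ->
      (tvar D (eball x r) <= (A * r `^ (n%:R - alpha))%:E)%E) ->
  forall (E : set (Rn R n)) (D : set 'rV[R]_n -> 'rV[R]_n),
    loc_finite_perimeter alpha E -> is_fgradient alpha E D ->
    forall B : set 'rV[R]_n, borel B ->
      (tvar D B <= (2 `^ (n%:R - alpha) * (A / omega (n%:R - alpha)))%:E *
                   hausdorff (n%:R - alpha) (B `&` reduced_boundary D))%E.
Proof.
move=> n0 alpha0 alpha1 A0 growth E D EP ED B mB.
have [rD DE _] := ED; have [_ Efin] := EP.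
set s := n%:R - alpha.
have s0 : 0 < s by rewrite subr_gt0 (lt_le_trans alpha1)// ler1n.
have finD C : borel C -> bounded_set C -> (tvar D C < +oo)%E.
  move=> mC /bounded_set_enorm[M _ CM].
  have mM : borel (eball (0 : 'rV[R]_n) M) by exact: borel_eball.
  apply: le_lt_trans (Efin (eball 0 M) (open_eball _ _) (bounded_eball _ _)).
  rewrite -DE; last exact: open_eball.
  by rewrite -!(tvar_measE D rD)//; exact: measure_le.
set mu := tvar_meas rD.
(* The Borel null set [N] contains the complement of the reduced boundary, so no measurability of
   the latter is at stake. *)
have [N [mN muN FN]] := negligible_setC_reduced_boundary D rD n0 finD.
have mBN : borel (B `\` N) by exact: measurableD.
(* The radius [rx] depends on the point; the sets [G k], with a uniform scale, increase and exhaust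
   the part of [B] off [N]. *)
pose G (k : nat) := growth_set mu A s k.+1%:R^-1.
have mG k : borel (G k) by apply: borel_closed; exact: closed_growth_set.
have BNG : B `\` N = \bigcup_k ((B `\` N) `&` G k).
  rewrite -setI_bigcupr setIidl// => x [Bx nNx].
  have [|rx rx0 rxP] := growth E D EP ED x; first by apply: contrapT => /FN.
  have [k _ kr] := near_infty_natSinv_lt (PosNum rx0).
  exists k => // r r0 rk; rewrite tvar_measE; last exact: borel_eball.
  by apply: rxP => //; apply: lt_trans rk (kr k (leqnn k)).
rewrite -(tvar_measE D rD)// -/mu.
apply: (@le_trans _ _ (mu (B `\` N))).
  apply: (@le_trans _ _ (mu (N `|` (B `\` N)))).
    apply: measure_le => //; first exact: measurableU.
    by move=> x Bx; have [|] := pselect (N x); [left|right].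
  by apply: le_trans (measureU2 _ mN mBN) _; rewrite [X in (X + _)%E]muN add0e.
rewrite leNgt; apply/negP; rewrite {1}BNG => /bigcup_lt_measure[||k].
- by move=> k; apply: measurableI; [exact: mBN|exact: mG].
- move=> i j ij; apply/subsetPset; apply: setIS => x Gx r r0 rj.
  by apply: Gx => //; apply: lt_le_trans rj _; rewrite lef_pV2 ?posrE// ler_nat ltnS.
- apply/negP; rewrite -leNgt.
  apply: (le_hausdorff_growth _ _ _ A0 s0 (omega_gt0 _ s0) k.+1%:R^-1) => //.
  + by apply: measurableI; [exact: mBN|exact: mG].
  + by move=> x [[Bx nN] _]; split=> //; apply: contrapT => /FN.
Qed.
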